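(* Let $\Lambda_\varepsilon$, $\varepsilon\in E=[0,\epsilon]$, be a family of $c$-dimensional normally hyperbolic invariant manifolds of the ODEs $q'=f_\varepsilon(q)$ in $\mathbb{R}^{n}$, $n=c+u+s$, with unstable dimension $u$ and stable dimension $s$, where $u<s$, whose center-unstable and center-stable manifolds $W^{cu}_{\Lambda_\varepsilon},W^{cs}_{\Lambda_\varepsilon}$ have $C^2$ parameterisations $w^{cu},w^{cs}$ and local coordinates $(x,y,v,z)\in\mathbb{R}^u\times\mathbb{R}^u\times\mathbb{R}^{s-u}\times\mathbb{R}^c$ as described in the context. Let $U\subset\mathbb{R}^u$, $V\subset\mathbb{R}^{s-u}$, $K\subset\mathbb{R}^c$ be open and let $\mathrm{cu}:E\times U\times K\to\mathbb{R}^u\times\mathbb{R}^c$ and $\mathrm{cs}:E\times U\times V\times K\to\mathbb{R}^s\times\mathbb{R}^c$ be $C^2$ functions such that on their domains $$\pi_{(x,z)}w^{cu}(\varepsilon,\mathrm{cu}(\varepsilon,x,z))=(x,z),\qquad \pi_{(x,v,z)}w^{cs}(\varepsilon,\mathrm{cs}(\varepsilon,x,v,z))=(x,v,z).$$ Fix $z^*\in K$, write $v^*(\varepsilon,x)=\pi_vw^{cu}(\varepsilon,\mathrm{cu}(\varepsilon,x,z^* ))$, which is assumed to lie in $V$ for all $(\varepsilon,x)\in E\times U$, and define $y:E\times U\to\mathbb{R}^u$ by $$y(\varepsilon,x)=\pi_yw^{cu}(\varepsilon,\mathrm{cu}(\varepsilon,x,z^* ))-\pi_yw^{cs}\bigl(\varepsilon,\mathrm{cs}(\varepsilon,x,v^*(\varepsilon,x),z^*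 )\bigr).$$ Assume that for some splitting $u=k_1+k_2$, $x=(x_1,x_2)$, $y=(y_1,y_2)$ (both in $\mathbb{R}^{k_1}\times\mathbb{R}^{k_2}$), one has: $U=B(p,R)$ for some $R>0$ and $p\in\mathbb{R}^u$ with $y(0,p)=0$; $y_2(0,x)=0$ for all $x\in U$; and, with $$A_{11}=\frac{\partial y_1}{\partial x_1}(0,p),\quad A_{22}=\frac{\partial^2 y_2}{\partial\varepsilon\partial x_2}(0,p),\quad \Delta_1=\left[\frac{\partial y_1}{\partial x}(E,U)-(A_{11},0)\right],\quad \Delta_2=\left[\frac{\partial^2 y_2}{\partial\varepsilon\partial x}(E,U)-(0,A_{22})\right],$$ the inequalities $$m(A_{11})R>\epsilon\left\|\frac{\partial y_1}{\partial\varepsilon}(E,p)\right\|+\|\Delta_1\|R,\qquad m(A_{22})R>\left\|\frac{\partial y_2}{\partial\varepsilon}(E,p)\right\|+\|\Delta_2\|R$$ hold. Then for any $\varepsilon\in(0,\epsilon]$ the manifolds $W^{cu}_{\Lambda_\varepsilon}$ and $W^{cs}_{\Lambda_\varepsilon}$ intersect transversally.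
   Context: Dynamical setting. $q'=f_\varepsilon(q)$ is a smooth family of ODEs in $\mathbb{R}^n$ with parameter $\varepsilon\in E=[0,\epsilon]$, $\epsilon>0$, and flow $\Phi^\varepsilon_t$. For $\varepsilon=0$ there is a normally hyperbolic invariant manifold $\Lambda_0$ of dimension $c$ with unstable coordinate of dimension $u$ and stable coordinate of dimension $s$; it survives for all $\varepsilon\in E$ as $\Lambda_\varepsilon$. The sets $W^{cu}_{\Lambda_\varepsilon}=\{q:\lim_{t\to-\infty}\mathrm{dist}(\Phi^\varepsilon_t(q),\Lambda_\varepsilon)=0\}$ and $W^{cs}_{\Lambda_\varepsilon}=\{q:\lim_{t\to+\infty}\mathrm{dist}(\Phi^\varepsilon_t(q),\Lambda_\varepsilon)=0\}$ are manifolds of dimension $c+u$ and $c+s$, respectively. Let $B_u$, $B_s$ be the unit balls in $\mathbb{R}^u$, $\mathbb{R}^s$ and $\Lambda$ a fixed $c$-dimensional manifold modelling all $\Lambda_\varepsilon$ (e.g. $\Lambda=\Lambda_0$). The functions $w^{cu}:E\times B_u\times\Lambda\to\mathbb{R}^n$ and $w^{cs}:E\times B_s\times\Lambda\to\mathbb{R}^n$ are $C^2$ and, for each $\varepsilon$, $w^{cu}(\varepsilon,\cdot)$ and $w^{cs}(\varepsilon,\cdot)$ parameterise (local) pieces of $W^{cu}_{\Lambda_\varepsilon}$ and $W^{cs}_{\Lambda_\varepsilon}$. The parameters in $B_u\times\Lambda$ and $B_s\times\Lambda$ are denoted $\mathrm{cu}$ and $\mathrm{cs}$, and locally (in a chart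 of $\Lambda$) are identified with points of $\mathbb{R}^u\times\mathbb{R}^c$ and $\mathbb{R}^s\times\mathbb{R}^c$. Local coordinates. Locally in $\mathbb{R}^n$ there are coordinates $(x,y,v,z)\in\mathbb{R}^u\times\mathbb{R}^u\times\mathbb{R}^{s-u}\times\mathbb{R}^c$, with projections denoted $\pi_y$, $\pi_v$, $\pi_{(x,z)}$, $\pi_{(x,v,z)}$, such that: (A) every matrix in $[\frac{\partial\pi_{(x,z)}w^{cu}}{\partial\mathrm{cu}}(E\times U')]$ is invertible, and (B) every matrix in $[\frac{\partial\pi_{(x,v,z)}w^{cs}}{\partial\mathrm{cs}}(E\times S')]$ is invertible, where $U'\subset\mathbb{R}^u\times\mathbb{R}^c$ and $S'\subset\mathbb{R}^s\times\mathbb{R}^c$ are bounded open sets of parameters (with images in the coordinate region); $U\times K\subset\pi_{(x,z)}w^{cu}(E\times U')$ and $U\times V\times K\subset\pi_{(x,v,z)}w^{cs}(E\times S')$, and $\mathrm{cu},\mathrm{cs}$ take values in $U',S'$. Notation. Fix norms on $\mathbb{R}^{k_1},\mathbb{R}^{k_2}$ and put $\|(x_1,x_2)\|=\max(\|x_1\|,\|x_2\|)$; $B(p,R)$ is the open ball in this norm; matrix norms are induced operator norms; $\|S\|=\sup_{s\in S}\|s\|$ for a set $S$. $m(A)=1/\|A^{-1}\|$ if $\det A\ne0$, else $m(A)=0$. $g(E,U)=\{g(\varepsilon,x):\varepsilon\in E,x\in U\}$ and $g(E,p)=\{g(\varepsilon,p):\varepsilon\in E\}$. $[S]$ is an interval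 enclosure: a product of closed intervals (one for each entry) containing $S$. $(A_{11},0)$ and $(0,A_{22})$ are block matrices of sizes $k_1\times u$ and $k_2\times u$. If $k_1=0$ or $k_2=0$ the corresponding inequality is omitted. *)

(* Defs.v *)
From HB Require Import structures.
From mathcomp Require Import all_boot all_order all_algebra.
From mathcomp Require Import all_classical all_reals all_analysis.
Set Implicit Arguments.
Unset Strict Implicit.
Unset Printing Implicit Defensive.
Import Order.TTheory GRing.Theory Num.Theory.
Import numFieldTopology.Exports numFieldNormedType.Exports.
Local Open Scope classical_set_scope.
Local Open Scope ring_scope.

(* Points of R^k are row vectors and matrices act on them from the right, so
   ['J f p] is the transpose of the usual matrix of partial derivatives; a
   matrix written with k1 rows and u columns on paper has type 'M_(u, k1). *)

Section Differentiability.
Context {R : realType} {V W : normedModType R}.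

(* For finite dimensional V this is the usual notion of a C^k map on an open
   set G. *)
Fixpoint Ck (k : nat) (f : V -> W) (G : set V) : Prop :=
  if k is k'.+1 then
    (forall x, G x -> differentiable f x) /\ (forall v, Ck k' ('D_v f) G)
  else forall x, G x -> {for x, continuous f}.

(* C^k on a set which need not be open, such as [0, epsilon] x U. *)
Definition Ck_on (k : nat) (f : V -> W) (A : set V) : Prop :=
  exists (G : set V) (g : V -> W),
    [/\ open G, A `<=` G, Ck k g G & forall x, A x -> f x = g x].

End Differentiability.

(* One-sided at the end points when E is an interval. *)
Definition derive_within {R : realType} {V : normedModType R} (E : set R)
    (f : R -> V) (e : R) : V :=
  lim ((fun s => (s - e)^-1 *: (f s - f e)) @ within E (e^')).

Section Norms.
Context {R : realType}.

Definition is_norm (k : nat) (N : 'rV[R]_k -> R) : Prop :=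
  [/\ forall x y, N (x + y) <= N x + N y,
      forall a x, N (a *: x) = `|a| * N x
    & forall x, N x = 0 -> x = 0].

Definition max_norm (k1 k2 : nat) (N1 : 'rV[R]_k1 -> R) (N2 : 'rV[R]_k2 -> R)
    (x : 'rV[R]_(k1 + k2)) : R :=
  Num.max (N1 (lsubmx x)) (N2 (rsubmx x)).

Definition norm_ball (k : nat) (N : 'rV[R]_k -> R) (p : 'rV[R]_k) (r : R) :
    set 'rV[R]_k :=
  [set x | N (x - p) < r].

Definition unit_ball (k : nat) : set 'rV[R]_k :=
  [set x | \sum_i x 0 i ^+ 2 < 1].

Definition opnorm (k l : nat) (N : 'rV[R]_k -> R) (N' : 'rV[R]_l -> R)
    (A : 'M[R]_(k, l)) : R :=
  sup [set N' (x *m A) | x in [set x | N x <= 1]].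

Definition set_norm (T : Type) (N : T -> R) (S : set T) : R :=
  sup [set N s | s in S].

Definition min_expansion (k : nat) (N : 'rV[R]_k -> R) (A : 'M[R]_k) : R :=
  if \det A != 0 then (opnorm N N (invmx A))^-1 else 0.

Definition is_enclosure (k l : nat) (B S : set 'M[R]_(k, l)) : Prop :=
  exists lo hi : 'M[R]_(k, l),
    B = [set M | forall i j, lo i j <= M i j <= hi i j] /\ S `<=` B.

(* The two index types may be equal only propositionally. *)
Definition mx_invertible (k l : nat) (A : 'M[R]_(k, l)) : Prop :=
  exists B : 'M[R]_(l, k), A *m B = 1%:M /\ B *m A = 1%:M.

Definition enclosure_invertible (k l : nat) (S : set 'M[R]_(k, l)) : Prop :=
  exists2 B, is_enclosure B S & forall M, B M -> mx_invertible M.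

End Norms.

(* A chart is a parameterisation by an open subset of R^d, not its inverse. *)
Record chart (R : realType) (d : nat) (T : Type) := Chart {
  cdom : set 'rV[R]_d ;
  cpar :> 'rV[R]_d -> T }.

Section Manifolds.
Context {R : realType}.

(* A is an atlas of a (Hausdorff, second countable) C^2 manifold of dimension d
   on the set M. The topology of M is the one defined by A; when M is a subset
   of R^n it may be finer than the subspace topology. *)
Definition is_atlas (d : nat) (T : Type) (M : set T) (A : set (chart R d T)) :
    Prop :=
  [/\ forall a, A a -> [/\ open (cdom a), set_inj (cdom a) a
                         & a @` cdom a `<=` M],
      exists B, [/\ B `<=` A, countable B
                  & forall x, M x -> exists2 a, B a & (a @` cdom a) x],
      forall a b, A a -> A b ->
        let D := cdom a `&` a @^-1` (b @` cdom b) in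
        open D /\ exists2 tau : 'rV[R]_d -> 'rV[R]_d,
          Ck 2 tau D & forall s, D s -> cdom b (tau s) /\ b (tau s) = a s
    & forall x y, M x -> M y -> x <> y ->
        exists (a b : chart R d T) (Oa Ob : set 'rV[R]_d),
          [/\ A a, A b, open Oa, open Ob &
              [/\ Oa `<=` cdom a, Ob `<=` cdom b, (a @` Oa) x, (b @` Ob) y
                & a @` Oa `&` b @` Ob = set0]]].

Definition is_immersed (d n : nat) (M : set 'rV[R]_n)
    (A : set (chart R d 'rV[R]_n)) : Prop :=
  is_atlas M A /\
  forall a, A a -> Ck 2 a (cdom a) /\
    forall s, cdom a s -> row_free ('J a s).

Definition is_embedded (d n : nat) (M : set 'rV[R]_n)
    (A : set (chart R d 'rV[R]_n)) : Prop :=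
  is_immersed M A /\
  forall a O, A a -> open O -> O `<=` cdom a ->
    exists2 Q : set 'rV[R]_n, open Q & a @` O = M `&` Q.

Definition push_atlas (d : nat) (T T' : Type) (h : T -> T')
    (A : set (chart R d T)) : set (chart R d T') :=
  [set Chart (cdom a) (h \o a) | a in A].

(* By compatibility of the charts of A, any one chart through q gives all
   tangent vectors. *)
Definition tangent (d n : nat) (A : set (chart R d 'rV[R]_n)) (q : 'rV[R]_n) :
    set 'rV[R]_n :=
  [set v | exists a s h, [/\ A a, cdom a s, a s = q & v = h *m 'J a s]].

(* Some point of intersection is transversal; M1 and M2 may also meet
   elsewhere. *)
Definition intersect_transversally (d1 d2 n : nat)
    (M1 : set 'rV[R]_n) (A1 : set (chart R d1 'rV[R]_n))
    (M2 : set 'rV[R]_n) (A2 : set (chart R d2 'rV[R]_n)) : Prop :=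
  exists q, [/\ M1 q, M2 q
    & forall v, exists v1 v2, [/\ tangent A1 q v1, tangent A2 q v2
                                & v = v1 + v2]].

End Manifolds.

Section Dynamics.
Context {R : realType} {n : nat}.

Definition is_flow (f : 'rV[R]_n -> 'rV[R]_n) (Phi : R -> 'rV[R]_n -> 'rV[R]_n) :
    Prop :=
  forall q, Phi 0 q = q /\
    forall t, is_derive (t : R^o) (1 : R^o) (fun s : R^o => Phi s q)
                (f (Phi t q)).

(* Subspaces are row spaces of matrices. The sum of the three subspaces is
   direct when n is the sum of the dimensions. *)
Definition normally_hyperbolic (Phi : R -> 'rV[R]_n -> 'rV[R]_n)
    (d u s : nat) (M : set 'rV[R]_n) (A : set (chart R d 'rV[R]_n)) : Prop :=
  (forall t, Phi t @` M `<=` M) /\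
  exists (Eu Es : 'rV[R]_n -> 'M[R]_n) (C lambda mu : R),
    [/\ 0 < C, 0 <= mu & mu < lambda] /\
    forall q, M q ->
      [/\ \rank (Eu q) = u, \rank (Es q) = s
        & forall v, exists v0 vu vs,
            [/\ tangent A q v0, (vu <= Eu q)%MS, (vs <= Es q)%MS
              & v = v0 + vu + vs]] /\
      [/\ forall t v, (v <= Eu q)%MS -> ('D_v (Phi t) q <= Eu (Phi t q))%MS,
          forall t v, (v <= Es q)%MS -> ('D_v (Phi t) q <= Es (Phi t q))%MS,
          forall t v, (v <= Eu q)%MS -> t <= 0 ->
            `|'D_v (Phi t) q| <= C * expR (lambda * t) * `|v|,
          forall t v, (v <= Es q)%MS -> 0 <= t ->
            `|'D_v (Phi t) q| <= C * expR (- (lambda * t)) * `|v|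
        & forall t v, tangent A q v ->
            `|'D_v (Phi t) q| <= C * expR (mu * `|t|) * `|v|].

Definition Wcu (Phi : R -> 'rV[R]_n -> 'rV[R]_n) (M : set 'rV[R]_n) :
    set 'rV[R]_n :=
  [set q | edist_inf M (Phi t q) @[t --> -oo%R] --> 0%E].

Definition Wcs (Phi : R -> 'rV[R]_n -> 'rV[R]_n) (M : set 'rV[R]_n) :
    set 'rV[R]_n :=
  [set q | edist_inf M (Phi t q) @[t --> +oo%R] --> 0%E].

End Dynamics.

Section Parameterisations.
Context {R : realType} {n k c : nat} {Lam : Type}.

(* w expressed in a chart of the model manifold. *)
Definition in_chart (a : chart R c Lam)
    (w : R -> 'rV[R]_k -> Lam -> 'rV[R]_n) (e : R) (t : 'rV[R]_(k + c)) :
    'rV[R]_n :=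
  w e (lsubmx t) (a (rsubmx t)).

Definition chart_dom (a : chart R c Lam) : set 'rV[R]_(k + c) :=
  [set t | unit_ball (lsubmx t) /\ cdom a (rsubmx t)].

(* Being a chart in the atlas A e, w e is an immersion onto an open piece, in the
   intrinsic topology, of the manifold with that atlas. The C^2 condition is on
   E x (unit ball) x (model manifold), read in each chart of the latter. *)
Definition parameterises (E : set R) (AL : set (chart R c Lam))
    (A : R -> set (chart R (k + c) 'rV[R]_n))
    (w : R -> 'rV[R]_k -> Lam -> 'rV[R]_n) : Prop :=
  forall a, AL a ->
    Ck_on 2 (fun t : R^o * 'rV[R]_(k + c) => in_chart a w t.1 t.2)
      (E `*` chart_dom a) /\
    forall e, E e -> A e (Chart (chart_dom a) (in_chart a w e)).

End Parameterisations.

Section Coordinates.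
Context {R : realType} {u m c : nat}.
Let coords := ('rV[R]_u * 'rV[R]_u * 'rV[R]_m * 'rV[R]_c)%type.

Definition prx (t : coords) : 'rV[R]_u := t.1.1.1.
Definition pry (t : coords) : 'rV[R]_u := t.1.1.2.
Definition prv (t : coords) : 'rV[R]_m := t.1.2.
Definition prz (t : coords) : 'rV[R]_c := t.2.
Definition prxz (t : coords) : 'rV[R]_(u + c) := row_mx (prx t) (prz t).
Definition prxvz (t : coords) : 'rV[R]_(u + m + c) :=
  row_mx (row_mx (prx t) (prv t)) (prz t).

Definition local_coordinates (n : nat) (O : set 'rV[R]_n)
    (chi : 'rV[R]_n -> coords) : Prop :=
  [/\ open O, Ck 2 chi O, open (chi @` O)
    & exists2 h : coords -> 'rV[R]_n,
        Ck 2 h (chi @` O) & forall q, O q -> h (chi q) = q].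

End Coordinates.

(* Main.v *)
Require Import Defs.
From HB Require Import structures.
From mathcomp Require Import all_boot all_order all_algebra.
From mathcomp Require Import all_classical all_reals all_analysis.
From mathcomp Require Import ring.
Import Order.TTheory GRing.Theory Num.Theory.
Import numFieldTopology.Exports numFieldNormedType.Exports.
Local Open Scope classical_set_scope.
Local Open Scope ring_scope.

Set Implicit Arguments.
Unset Strict Implicit.

(* Fix e > 0. Since y2(0, .) = 0, the mean value theorem in e puts each entry of
   e^-1 dy2/dx(e, x) between the bounds of (0, A22) + Delta2, while dy1/dx(e, x)
   lies in (A11, 0) + Delta1. Hence g = (y1, e^-1 y2) differs from the linear
   map diag(A11, A22) by terms so small that the Newton map
   x - g(x) diag(A11, A22)^-1 is a contraction of a closed ball inside U: the
   numbers eps |dy1/de(E, p)| and |dy2/de(E, p)| bound the two components of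
   g(p). Its fixed point is a zero of y(e, .), at which the derivative of y is
   invertible by the same estimate. At such a zero the two manifolds meet, and
   in the coordinates (x, y, v, z) their tangent spaces are graphs over (x, z)
   and (x, v, z), whose sum is everything as soon as dy/dx is invertible. *)

(** The factor epsilon occurs in the first inequality only: y1(e, p) is at most e times the supremum
    of |dy1/de|, hence at most epsilon times it, whereas dividing y2 by e cancels that factor.
    Multiplied by the norm of the inverse of its diagonal block, each inequality bounds one
    component of the Newton map by r. The maximum norm keeps the two blocks independent, and the
    larger of their contraction constants serves for both.

    The mean value theorem need not provide one intermediate point for all entries of a Jacobian. An
    enclosure is a product of intervals, so a matrix whose entries come from different points still
    lies in it.

    E is a closed interval, and C^2 on E x U refers to an extension to an open set. Derivatives in x
    are taken on the open set U and derivatives in e as limits inside E; both are identified with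
    partial derivatives of the extension.

    The norms are arbitrary. Comparison with the sup norm of row vectors supplies compactness of
    balls and the boundedness behind the suprema. *)

(** * Differentials: dependence on germs, finite frames, products and linear maps *)

Section DirectionalCalculus.
Context {R : realType}.
Implicit Types U V W Z : normedModType R.

(** The first-order expansion at x involves only the germ of the map. This is what allows a map
    known on a set to be replaced by a smooth extension of it. *)
Lemma near_eq_differentiable V W (f g : V -> W) (x : V) :
  {near x, f =1 g} -> differentiable f x ->
  differentiable g x /\ ('d g x = 'd f x :> (V -> W)).
Proof.
move=> fg df.
have fgx : f x = g x by exact: nbhs_singleton fg.
have E : g \o shift x = cst (g x) + 'd f x +o_ 0 id.
  have /eqaddoP df' := diff_locally df.
  have fg0 : \forall h \near nbhs (0 : V), f (h + x) = g (h + x).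
    by move: fg; rewrite (near_shift 0) subr0.
  apply/eqaddoP => _/posnumP[e]; have dfe := df' e%:num [gt0 of e%:num].
  near=> h; have fgh : f (h + x) = g (h + x) by near: h; exact: fg0.
  suff : `|(f \o shift x - (cst (f x) + 'd f x)) h| <= e%:num * `|id h|.
    by rewrite !fctE /= -fgx fgh.
  by near: h; exact: dfe.
have H : 'd g x = 'd f x :> (V -> W).
  by apply: diff_unique => //; exact: (diff_continuous df).
split => //; apply/diff_locallyP; rewrite H; split => //.
exact: (diff_continuous df).
Unshelve. all: by end_near.
Qed.

(* Finite dimension, in a form stable under the products of spaces on which the
   maps below are defined. *)
Definition framed V : Prop :=
  exists (I : finType) (b : I -> V) (l : I -> {linear V -> R^o}),
    (forall i, continuous (l i)) /\ forall x, x = \sum_i l i x *: b i.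

Lemma framed_regular : framed (R^o : normedModType R).
Proof.
exists unit, (fun=> 1), (fun=> idfun); split=> [_ x //|x].
by rewrite big_const card_unit /= addr0 [_ *: _]mulr1.
Qed.

Lemma framed_rV n : framed 'rV[R]_n.
Proof.
exists 'I_n, (fun j => delta_mx 0 j).
have lin j : linear (fun x : 'rV[R]_n => x 0 j : R^o).
  by move=> a x y; rewrite !mxE.
exists (fun j => HB.pack_for {linear 'rV[R]_n -> R^o} (fun x : 'rV[R]_n => x 0 j : R^o)
  (GRing.isLinear.Build _ _ _ _ _ (lin j))).
by split=> [j x|x]; [exact: coord_continuous|exact: row_sum_delta].
Qed.

Lemma framed_prod V W : framed V -> framed W -> framed (V * W)%type.
Proof.
move=> [I [b [l [lc lb]]]] [J [b' [l' [lc' lb']]]].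
exists (I + J)%type, (fun k => match k with inl i => (b i, 0) | inr j => (0, b' j) end).
exists (fun k => match k with
  | inl i => (l i \o fst : {linear _ -> _})
  | inr j => (l' j \o snd : {linear _ -> _}) end).
split.
  case=> k x /=; apply: continuous_comp.
  - exact: cvg_fst.
  - exact: lc.
  - exact: cvg_snd.
  - exact: lc'.
case=> x y; rewrite big_sumType /=; apply: injective_projections => /=.
  rewrite !raddf_sum /= [X in _ = _ + X]big1 ?addr0; first exact: lb.
  by move=> i _; rewrite scaler0.
rewrite !raddf_sum /= [X in _ = X + _]big1 ?add0r; first exact: lb'.
by move=> i _; rewrite scaler0.
Qed.

Lemma framed_linear_continuous V W (L : {linear V -> W}) :
  framed V -> continuous L.
Proof.
move=> [I [b [l [lc lb]]]] x.
have -> : (L : V -> W) = (fun x => \sum_i l i x *: L (b i)).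
  apply/funext => z; rewrite {1}(lb z) linear_sum.
  by apply: eq_bigr => i _; rewrite linearZ.
apply: cvg_big => [|i _]; [exact: add_continuous|apply: cvgZr_tmp; exact: lc].
Qed.


Lemma scale_is_bilinear W :
  bilinear_for
    (GRing.Scale.Law.clone _ _ *:%R _) (GRing.Scale.Law.clone _ _ *:%R _)
    (fun (a : R^o) (w : W) => a *: w).
Proof.
split=> [w|a] c x y /=; first by rewrite scalerDl scalerA.
by rewrite scalerDr !scalerA mulrC.
Qed.

Lemma differentiable_scale V W (a : V -> R^o) (f : V -> W) x :
  differentiable a x -> differentiable f x ->
  differentiable (fun z => a z *: f z) x /\
  forall v, 'D_v (fun z => a z *: f z) x = a x *: 'D_v f x + 'D_v a x *: f x.
Proof.
move=> da df.
pose B : {bilinear R^o -> W -> W} := HB.pack_for {bilinear R^o -> W -> W}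
  (fun (a : R^o) (w : W) => a *: w)
  (bilinear_isBilinear.Build R R^o W W _ _ _ (scale_is_bilinear W)).
have Bc : continuous (fun p : R^o * W => B p.1 p.2) by exact: scale_continuous.
have dp := differentiable_pair da df.
have E : (fun z => a z *: f z) = (fun p => B p.1 p.2) \o (fun z => (a z, f z)).
  by [].
have dB : differentiable (fun p : R^o * W => B p.1 p.2) (a x, f x).
  exact: differentiable_bilin.
have dE : differentiable (fun z => a z *: f z) x.
  by rewrite E; exact: differentiable_comp.
split => // v; rewrite !deriveE // {1}E diff_comp //.
rewrite (_ : ('d _ (a x, f x) \o _) v =
  ('d (fun p : R^o * W => B p.1 p.2) (a x, f x))
    ('d (fun z => (a z, f z)) x v)) //.
by rewrite (diff_bilin _ Bc) diff_pair.
Qed.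

Lemma differentiable_linear_comp V W Z (L : {linear W -> Z}) (f : V -> W) x :
  continuous L -> differentiable f x ->
  differentiable (L \o f) x /\ forall v, 'D_v (L \o f) x = L ('D_v f x).
Proof.
move=> Lc df; have dL : differentiable L (f x) by exact: linear_differentiable.
have dLf : differentiable (L \o f) x by exact: differentiable_comp.
by split => // v; rewrite !deriveE // diff_comp //= diff_lin.
Qed.

End DirectionalCalculus.

(** * Closure properties of C^k maps on open sets and on arbitrary sets *)

Section SmoothMaps.
Context {R : realType}.
Implicit Types U V W Z : normedModType R.

Lemma near_eq_open V W (f g : V -> W) (G : set V) x :
  open G -> (forall z, G z -> f z = g z) -> G x -> {near x, f =1 g}.
Proof.
move=> oG fg Gx; apply: (@filterS _ _ _ G); first by move=> z /fg.
exact: open_nbhs_nbhs.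
Qed.

Lemma Ck_eq k V W (f g : V -> W) (G : set V) :
  open G -> (forall x, G x -> f x = g x) -> Ck k f G -> Ck k g G.
Proof.
move=> oG; elim: k f g => [|k IH] f g fg /=.
  move=> cf x Gx; have nfg := near_eq_open oG fg Gx.
  have cfx : f z @[z --> x] --> f x := cf x Gx.
  change (g z @[z --> x] --> g x); rewrite -(fg x Gx).
  exact: cvg_trans (near_eq_cvg nfg) cfx.
move=> [df dvf]; split=> [x Gx|v].
  by have [] := near_eq_differentiable (near_eq_open oG fg Gx) (df x Gx).
apply: IH (dvf v) => x Gx; apply: near_eq_derive; exact: near_eq_open fg Gx.
Qed.

Lemma Ck_sub k V W (f : V -> W) (G H : set V) :
  H `<=` G -> Ck k f G -> Ck k f H.
Proof.
move=> HG; elim: k f => [|k IH] f /=; first by move=> cf x /HG; exact: cf.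
by move=> [df dvf]; split=> [x /HG|v]; [exact: df|exact/IH/dvf].
Qed.

Lemma Ck_continuous k V W (f : V -> W) (G : set V) x :
  Ck k f G -> G x -> {for x, continuous f}.
Proof.
case: k => [|k] /=; first exact.
by move=> [df _] Gx; apply: differentiable_continuous; exact: df.
Qed.

Lemma CkW k V W (f : V -> W) (G : set V) : Ck k.+1 f G -> Ck k f G.
Proof.
elim: k f => [|k IH] f; first by move=> h x; exact: Ck_continuous h.
by move=> [df dvf]; split => // v; exact: IH.
Qed.

Lemma Ck_cst k V W (w : W) (G : set V) : Ck k (cst w) G.
Proof.
elim: k w => [|k IH] w; first by move=> x _; exact: cvg_cst.
split=> [x _|v]; first exact: differentiable_cst.
rewrite (_ : 'D_v (cst w) = cst 0); first exact: IH.
by apply/funext => x; rewrite derive_cst.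
Qed.

Lemma Ck_add k V W (f g : V -> W) (G : set V) :
  open G -> Ck k f G -> Ck k g G -> Ck k (f + g) G.
Proof.
move=> oG; elim: k f g => [|k IH] f g.
  by move=> cf cg x Gx; apply: cvgD; [exact: cf|exact: cg].
move=> [df dvf] [dg dvg]; split=> [x Gx|v].
  by apply: differentiableD; [exact: df|exact: dg].
apply: Ck_eq (IH _ _ (dvf v) (dvg v)) => // x Gx.
by rewrite deriveD //; apply: diff_derivable; [exact: df|exact: dg].
Qed.

Lemma Ck_sum k V W (I : finType) (f : I -> V -> W) (G : set V) :
  open G -> (forall i, Ck k (f i) G) -> Ck k (\sum_i f i) G.
Proof.
move=> oG cf; elim/big_ind: _ => [|g h|i _]; last exact: cf.
- exact: Ck_cst.
- exact: Ck_add.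
Qed.

Lemma Ck_linear_comp k V W Z (L : {linear W -> Z}) (f : V -> W) (G : set V) :
  continuous L -> open G -> Ck k f G -> Ck k (L \o f) G.
Proof.
move=> Lc oG; elim: k f => [|k IH] f.
  by move=> cf x Gx; apply: continuous_comp; [exact: cf|exact: Lc].
move=> [df dvf]; split=> [x Gx|v].
  by have [] := differentiable_linear_comp Lc (df x Gx).
apply: Ck_eq (IH _ (dvf v)) => // x Gx /=.
by have [_ ->] := differentiable_linear_comp Lc (df x Gx).
Qed.

Lemma Ck_scale k V W (a : V -> R^o) (f : V -> W) (G : set V) :
  open G -> Ck k a G -> Ck k f G -> Ck k (fun z => a z *: f z) G.
Proof.
move=> oG; elim: k a f => [|k IH] a f.
  by move=> ca cf x Gx; apply: cvgZ; [exact: ca|exact: cf].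
move=> aC fC; have [da dva] := aC; have [df dvf] := fC; split=> [x Gx|v].
  by have [] := differentiable_scale (da x Gx) (df x Gx).
apply: Ck_eq (Ck_add oG (IH _ _ (CkW aC) (dvf v)) (IH _ _ (dva v) (CkW fC))) => //.
move=> x Gx; rewrite /= fctE.
by have [_ ->] := differentiable_scale (da x Gx) (df x Gx).
Qed.

(* The derivative [D_v (g \o f)] is the sum, over a frame of the intermediate
   space, of the products of [l_i (D_v f)] and [D_(b_i) g \o f], so that the
   induction hypothesis applies to the second factor. *)
Lemma Ck_comp k V W Z (f : V -> W) (g : W -> Z) (G : set V) (H : set W) :
  framed W -> open G -> (forall x, G x -> H (f x)) ->
  Ck k f G -> Ck k g H -> Ck k (g \o f) G.
Proof.
move=> frW oG fGH; have [I [b [l [lc lb]]]] := frW.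
elim: k f g fGH => [|k IH] f g fGH.
  move=> cf cg x Gx; apply: continuous_comp; first exact: cf.
  by apply: cg; exact: fGH.
move=> fC [dg dvg]; have [df dvf] := fC; split=> [x Gx|v].
  by apply: differentiable_comp; [exact: df|apply: dg; exact: fGH].
pose D := \sum_i (fun x => (l i \o 'D_v f) x *: ('D_(b i) g \o f) x).
have DC : Ck k D G.
  apply: Ck_sum => // i; apply: Ck_scale => //.
    by apply: Ck_linear_comp => //; exact: dvf.
  by apply: IH => //; [exact: (CkW fC)|exact: dvg].
apply: Ck_eq DC => // x Gx; have dfx := df x Gx; have dgx := dg _ (fGH x Gx).
rewrite deriveE; last exact: differentiable_comp.
rewrite diff_comp //= -(deriveE v dfx) [in RHS](lb ('D_v f x)) linear_sum /D fct_sumE.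
by apply: eq_bigr => i _; rewrite linearZ /= (deriveE (b i) dgx).
Qed.

Lemma Ck_on_eq k V W (f g : V -> W) (A : set V) :
  (forall x, A x -> f x = g x) -> Ck_on k f A -> Ck_on k g A.
Proof.
move=> fg [G [h [oG AG hC fh]]]; exists G, h; split => // x Ax.
by rewrite -fg // fh.
Qed.

(** The extensions compose only where the first takes values in the domain of the second. That set
    is open by continuity of the first extension, and it contains A. *)
Lemma Ck_on_comp k V W Z (f : V -> W) (g : W -> Z) (A : set V) (B : set W) :
  framed W -> (forall x, A x -> B (f x)) ->
  Ck_on k f A -> Ck_on k g B -> Ck_on k (g \o f) A.
Proof.
move=> frW fAB [G [f' [oG AG f'C ff']]] [H [g' [oH BH g'C gg']]].
have o : open (G `&` f' @^-1` H).
  rewrite openE => x [Gx Hx]; apply: filterI; first exact: open_nbhs_nbhs.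
  apply: (Ck_continuous f'C Gx); exact: open_nbhs_nbhs.
exists (G `&` f' @^-1` H), (g' \o f'); split => //.
- by move=> x Ax; split; [exact: AG|rewrite /= -ff' //; exact/BH/fAB].
- apply: (@Ck_comp _ _ _ _ _ _ _ H) => //; first by move=> x [].
  by apply: Ck_sub f'C => x [].
- by move=> x Ax /=; rewrite -ff' // gg' //; exact: fAB.
Qed.

Lemma Ck_on_open k V W (f : V -> W) (G : set V) :
  open G -> Ck k f G -> Ck_on k f G.
Proof. by move=> oG fC; exists G, f; split. Qed.

Lemma Ck_on_cst k V W (w : W) (A : set V) : Ck_on k (cst w) A.
Proof. by exists setT, (cst w); split => //; [exact: openT|exact: Ck_cst]. Qed.

Lemma Ck_id k V (G : set V) : Ck k id G.
Proof.
case: k => [|k]; first by move=> x _.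
split=> [x _|v]; first by [].
rewrite (_ : 'D_v id = cst v); first exact: Ck_cst.
by apply/funext => x; rewrite derive_id.
Qed.

Lemma Ck_on_linear_comp k V W Z (L : {linear W -> Z}) (f : V -> W) (A : set V) :
  framed W -> Ck_on k f A -> Ck_on k (L \o f) A.
Proof.
move=> frW [G [g [oG AG gC fg]]]; exists G, (L \o g); split => //.
  by apply: Ck_linear_comp => //; exact: framed_linear_continuous.
by move=> x Ax /=; rewrite fg.
Qed.

Lemma Ck_on_linear k V W (L : {linear V -> W}) (A : set V) :
  framed V -> Ck_on k L A.
Proof.
move=> frV; apply: (@Ck_on_linear_comp k _ _ _ L id) => //.
by exists setT, id; split => //; [exact: openT|exact: Ck_id].
Qed.

Lemma Ck_on_add k V W (f g : V -> W) (A : set V) :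
  Ck_on k f A -> Ck_on k g A -> Ck_on k (f + g) A.
Proof.
move=> [G [f' [oG AG f'C ff']]] [H [g' [oH AH g'C gg']]].
have oGH : open (G `&` H) by exact: openI.
exists (G `&` H), (f' + g'); split => //.
- by move=> x Ax; split; [exact: AG|exact: AH].
- by apply: Ck_add => //; [apply: Ck_sub f'C|apply: Ck_sub g'C] => x [].
- by move=> x Ax; rewrite fctE /= ff' // gg'.
Qed.

(** A pair is the sum of its images under the two linear embeddings into the product, so closure
    under sums and linear maps suffices. *)
Lemma Ck_on_pair k V W Z (f : V -> W) (g : V -> Z) (A : set V) :
  framed W -> framed Z ->
  Ck_on k f A -> Ck_on k g A -> Ck_on k (fun x => (f x, g x)) A.
Proof.
move=> frW frZ fC gC.
have lin1 : linear (fun w : W => (w, 0 : Z)).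
  by move=> a x y; apply: injective_projections => //=; rewrite scaler0 addr0.
have lin2 : linear (fun z : Z => (0 : W, z)).
  by move=> a x y; apply: injective_projections => //=; rewrite scaler0 addr0.
pose L1 := HB.pack_for {linear W -> (W * Z)%type} (fun w : W => (w, 0 : Z))
  (GRing.isLinear.Build _ _ _ _ _ lin1).
pose L2 := HB.pack_for {linear Z -> (W * Z)%type} (fun z : Z => (0 : W, z))
  (GRing.isLinear.Build _ _ _ _ _ lin2).
apply: Ck_on_eq (Ck_on_add (Ck_on_linear_comp L1 frW fC)
  (Ck_on_linear_comp L2 frZ gC)) => x Ax.
by rewrite fctE /=; apply: injective_projections; rewrite /= ?addr0 ?add0r.
Qed.

End SmoothMaps.

(** * Arbitrary norms on row vectors: equivalence with the sup norm and a mean value inequality *)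

Section FiniteDimensionalNorms.
Context {R : realType}.

Section OneNorm.
Context {k : nat} {N : 'rV[R]_k -> R} (hN : is_norm N).

Lemma gnormD x y : N (x + y) <= N x + N y. Proof. by case: hN. Qed.
Lemma gnormZ a x : N (a *: x) = `|a| * N x. Proof. by case: hN. Qed.
Lemma gnorm_eq0 x : N x = 0 -> x = 0. Proof. by case: hN => _ _; exact. Qed.

Lemma gnorm0 : N 0 = 0.
Proof. by rewrite -(scale0r (0 : 'rV_k)) gnormZ normr0 mul0r. Qed.

Lemma gnormN x : N (- x) = N x.
Proof. by rewrite -scaleN1r gnormZ normrN1 mul1r. Qed.

Lemma gnorm_ge0 x : 0 <= N x.
Proof.
have := gnormD x (- x); rewrite subrr gnorm0 gnormN -mulr2n.
by rewrite pmulrn_lge0.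
Qed.

Lemma gnorm_le_add x y : N x <= N y + N (x - y).
Proof. by rewrite -[x in leLHS](subrK y) [leRHS]addrC gnormD. Qed.

Lemma gnorm_le_mx : exists2 C, 0 < C & forall x, N x <= C * `|x|.
Proof.
(* The summand 1 keeps the constant positive when k = 0. *)
exists (1 + \sum_(j < k) N (delta_mx 0 j)).
  by rewrite ltr_wpDr // sumr_ge0 // => j _; exact: gnorm_ge0.
move=> x; apply: (@le_trans _ _ (\sum_(j < k) `|x| * N (delta_mx 0 j))).
  rewrite [x in N x]row_sum_delta.
  apply: (@le_trans _ _ (\sum_(j < k) N (x 0 j *: delta_mx 0 j))).
    elim/big_ind2: _ => [|a b c d ab cd|//]; first by rewrite gnorm0.
    by apply: le_trans (gnormD _ _) _; exact: lerD.
  apply: ler_sum => j _; rewrite gnormZ; apply: ler_wpM2r.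
    exact: gnorm_ge0.
  by rewrite [leRHS]/Num.norm /= mx_normrE; exact: (le_bigmax _ _ (0, j)).
by rewrite -mulr_sumr mulrC ler_wpM2r // lerDr.
Qed.

Lemma gnorm_continuous : continuous N.
Proof.
have [C C0 hC] := gnorm_le_mx; move=> x; apply/(@cvgrPdist_le R R^o _ (nbhs x)) => e e0.
have ec : 0 < e / C by rewrite divr_gt0.
apply: filterS (nbhsx_ballx x _ ec) => y; rewrite -ball_normE => /ltW /= xy.
have h z : N z <= C * (e / C) -> N z <= e by rewrite mulrCA mulfV ?mulr1 // gt_eqF.
rewrite ler_distl; apply/andP; split.
  rewrite lerBlDr; apply: le_trans (gnorm_le_add _ x) _; rewrite lerD2l.
  by apply/h; apply: le_trans (hC _) _; rewrite ler_pM2l // distrC.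
apply: le_trans (gnorm_le_add _ y) _; rewrite lerD2l.
by apply/h; apply: le_trans (hC _) _; rewrite ler_pM2l.
Qed.

(** N is continuous, so it attains a minimum on the compact unit sphere of the sup norm. The minimum
    is positive because N vanishes only at 0, and its inverse is the constant. *)
Lemma mx_le_gnorm : exists2 C, 0 < C & forall x, `|x| <= C * N x.
Proof.
pose S := [set x : 'rV[R]_k | `|x| = 1].
(* If the sphere is empty, rescaling shows that every vector is 0, and any constant will do. *)
have [[x0 Sx0]|S0] := pselect (S !=set0); last first.
  exists 1 => // x; have [->|x0] := eqVneq x 0; first by rewrite normr0 mul1r gnorm_ge0.
  exfalso; apply: S0; exists (`|x|^-1 *: x); rewrite /S /= normrZ normfV normr_id.
  by rewrite mulVf // normr_eq0.
have cS : compact S.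
  apply: bounded_closed_compact.
    by exists 1; split => // M M1 x Sx; change (`|x| <= M); rewrite Sx ltW.
  rewrite (_ : S = (fun x : 'rV[R]_k => `|x|) @^-1` [set 1]) //.
  apply: closed_comp; last exact: closed_eq.
  by move=> x _; exact: norm_continuous.
have cN : {within S, continuous N}.
  exact/continuous_subspaceT/gnorm_continuous.
have [c] := EVT_min_rV (ex_intro _ x0 Sx0) cS cN; rewrite inE => Sc cmin.
have Nc : 0 < N c.
  rewrite lt_neqAle gnorm_ge0 andbT eq_sym; apply/eqP => /gnorm_eq0 c0.
  by move: Sc; rewrite /S /= c0 normr0 => /eqP; rewrite eq_sym oner_eq0.
exists (N c)^-1; first by rewrite invr_gt0.
move=> x; have [->|x_neq0] := eqVneq x 0; first by rewrite normr0 gnorm0 mulr0.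
have nx : 0 < `|x| by rewrite normr_gt0.
rewrite mulrC ler_pdivlMr // mulrC -ler_pdivlMr //.
have := cmin (`|x|^-1 *: x); rewrite gnormZ normfV normr_id mulrC; apply.
by rewrite inE /S /= normrZ normfV normr_id mulVf // gt_eqF.
Qed.

(* Maximising [t |-> N (psi b - psi t) + (M + d) t] over [[a, b]]: a maximum
   cannot be attained before [b], because there [psi] moves at speed less than
   [M + d]. *)
Lemma gnorm_mean_value (psi : R -> 'rV[R]_k) (M a b : R) : a <= b ->
  (forall t, t \in `[a, b] -> derivable psi t 1 /\ N ('D_1 psi t) <= M) ->
  N (psi b - psi a) <= M * (b - a).
Proof.
move=> ab hpsi; apply/ler_addgt0Pr => e0 e0_gt0.
(* The slack in speed, chosen so that it costs at most [e0] over the whole interval; the 1 in the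
   denominator allows a = b. *)
pose d := e0 / (b - a + 1).
have bap : 0 < b - a + 1 by rewrite ltr_wpDl // subr_ge0.
have d0 : 0 < d by rewrite divr_gt0.
have dle : d * (b - a) <= e0.
  by rewrite /d mulrAC ler_pdivrMr // ler_pM2l // lerDl.
apply: (@le_trans _ _ ((M + d) * (b - a))); last by rewrite mulrDl lerD2l.
pose al t := N (psi b - psi t) + (M + d) * t.
have cal : {within `[a, b], continuous al}.
  have cpsi : {within `[a, b], continuous psi}.
    by apply: derivable_within_continuous => t /hpsi [].
  have clin : {within `[a, b], continuous (fun t : R => (M + d) * t)}.
    by apply: continuous_subspaceT => t; exact: mulrl_continuous.
  move=> t; apply: cvgD; last exact: clin.
  apply: continuous_comp; last exact: gnorm_continuous.
  by apply: cvgB; [exact: cvg_cst|exact: cpsi].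
have [c cab cmax] := EVT_max ab cal.
have cb : c <= b by rewrite (itvP cab).
suff /eqP ceqb : c == b.
  have := cmax a; rewrite in_itv /= lexx ab => /(_ isT).
  by rewrite ceqb /al subrr gnorm0 add0r -lerBrDr -mulrBr.
rewrite eq_le cb /= leNgt; apply/negP => cltb.
have [dc Dc] := hpsi c cab.
have cv : N (h^-1 *: (psi (h *: 1 + c) - psi c)) @[h --> 0^'+] --> N ('D_1 psi c).
  apply: continuous_cvg; first exact: gnorm_continuous.
  exact: (cvg_dnbhs_at_right dc).
near (0 : R)^'+ => h.
have h0 : 0 < h by near: h; exact: nbhs_right_gt.
have hlt : N (h^-1 *: (psi (h *: 1 + c) - psi c)) < M + d.
  near: h; apply: (cvgr_lt _ cv); apply: le_lt_trans Dc _; by rewrite ltrDl.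
have hb : h < b - c by near: h; apply: nbhs_right_lt; rewrite subr_gt0.
have := cmax (h + c); rewrite in_itv /= => /(_ _) H.
have {H} : al (h + c) <= al c.
  apply: H; rewrite -lerBrDr (ltW hb) andbT.
  by rewrite ler_wpDl ?(ltW h0) // (itvP cab).
apply/negP; rewrite -ltNge /al mulrDr.
have hE : h *: 1 + c = h + c by congr (_ + _); exact: mulr1.
move: hlt; rewrite hE gnormZ gtr0_norm ?invr_gt0 // ltr_pdivrMl // => hlt.
rewrite addrA ltrD2r [h * _]mulrC in hlt *.
apply: (@le_lt_trans _ _ (N (psi b - psi (h + c)) + N (psi (h + c) - psi c))).
  apply: le_trans (gnormD _ _); by rewrite addrA subrK.
by rewrite ltrD2l.
Unshelve. all: by end_near. Qed.

End OneNorm.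

End FiniteDimensionalNorms.

(** * Maximum norms, operator norms and their suprema over boxes *)

Section OperatorNorms.
Context {R : realType}.

Lemma max_norm_is_norm k1 k2 (N1 : 'rV[R]_k1 -> R) (N2 : 'rV[R]_k2 -> R) :
  is_norm N1 -> is_norm N2 -> is_norm (max_norm N1 N2).
Proof.
move=> hN1 hN2; split; rewrite /max_norm.
- move=> x y; rewrite !linearD /= ge_max; apply/andP; split.
    by apply: le_trans (gnormD hN1 _ _) _; rewrite lerD // le_max lexx.
  by apply: le_trans (gnormD hN2 _ _) _; rewrite lerD // le_max lexx orbT.
- by move=> a x; rewrite !linearZ /= !gnormZ // maxr_pMr.
- move=> x x0; have : Num.max (N1 (lsubmx x)) (N2 (rsubmx x)) <= 0 by rewrite x0.
  rewrite ge_max => /andP[h1 h2].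
  have l0 : lsubmx x = 0.
    by apply: (gnorm_eq0 hN1); apply/le_anti; rewrite h1 gnorm_ge0.
  have r0 : rsubmx x = 0.
    by apply: (gnorm_eq0 hN2); apply/le_anti; rewrite h2 gnorm_ge0.
  by rewrite -[LHS]hsubmxK l0 r0 row_mx0.
Qed.

Lemma mx_entry_le m n (A : 'M[R]_(m, n)) i j : `|A i j| <= `|A|.
Proof. by rewrite [leRHS]/Num.norm /= mx_normrE; exact: (le_bigmax _ _ (i, j)). Qed.

Lemma mx_norm_le m n (A : 'M[R]_(m, n)) c :
  0 <= c -> (forall i j, `|A i j| <= c) -> `|A| <= c.
Proof.
move=> c0 h; rewrite [leLHS]/Num.norm /= mx_normrE.
by apply: bigmax_le => // -[i j] _; exact: h.
Qed.

Lemma mulmx_norm_le k l (x : 'rV[R]_k) (A : 'M[R]_(k, l)) :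
  `|x *m A| <= k%:R * (`|x| * `|A|).
Proof.
apply: mx_norm_le; first by rewrite mulr_ge0 // mulr_ge0.
move=> i j; rewrite mxE; apply: le_trans (ler_norm_sum _ _ _) _.
rewrite mulr_natl; have -> : `|x| * `|A| *+ k = \sum_(l' < k) `|x| * `|A|.
  by rewrite sumr_const card_ord.
apply: ler_sum => l' _.
by rewrite normrM ler_pM // mx_entry_le.
Qed.

Context {k l : nat} {N : 'rV[R]_k -> R} {N' : 'rV[R]_l -> R}.
Hypotheses (hN : is_norm N) (hN' : is_norm N').

(** Shows that the supremum in [opnorm] is taken over a set bounded above. As C does not depend on
    A, the bound also controls [opnorm] on bounded sets of matrices. *)
Lemma opnorm_bound : exists2 C, 0 <= C & forall A x, N x <= 1 -> N' (x *m A) <= C * `|A|.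
Proof.
have [C C0 hC] := mx_le_gnorm hN; have [C' C'0 hC'] := gnorm_le_mx hN'.
exists (C' * (k%:R * C)); first by rewrite mulr_ge0 ?(ltW C'0) // mulr_ge0 // ltW.
move=> A x Nx; apply: le_trans (hC' _) _; rewrite -mulrA ler_pM2l //.
apply: le_trans (mulmx_norm_le _ _) _; rewrite -mulrA ler_wpM2l // ler_wpM2r //.
by apply: le_trans (hC _) _; rewrite ger_pMr.
Qed.

Lemma opnorm_le A c : (forall x, N x <= 1 -> N' (x *m A) <= c) -> opnorm N N' A <= c.
Proof.
move=> h; apply: ge_sup; last by move=> _ [x /= Nx <-]; exact: h.
by exists (N' (0 *m A)), 0 => //=; rewrite gnorm0.
Qed.

Lemma le_opnorm A x : N' (x *m A) <= opnorm N N' A * N x.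
Proof.
have [C C0 hC] := opnorm_bound.
have ub y : N y <= 1 -> N' (y *m A) <= opnorm N N' A.
  move=> Ny; apply: ub_le_sup; last by exists y.
  by exists (C * `|A|) => _ [z /= Nz <-]; exact: hC.
have [Nx0|Nx0] := eqVneq (N x) 0.
  by rewrite (gnorm_eq0 hN Nx0) mul0mx !gnorm0 // mulr0.
have Nx : 0 < N x by rewrite lt_neqAle eq_sym Nx0 gnorm_ge0.
rewrite -ler_pdivrMr //; have := ub ((N x)^-1 *: x).
rewrite -scalemxAl !gnormZ // gtr0_norm ?invr_gt0 // mulVf // mulrC; exact.
Qed.

Lemma opnorm_ge0 A : 0 <= opnorm N N' A.
Proof.
have [C C0 hC] := opnorm_bound.
apply: (@le_trans _ _ (N' (0 *m A))); first exact: gnorm_ge0.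
apply: ub_le_sup; first by exists (C * `|A|) => _ [z /= Nz <-]; exact: hC.
by exists 0 => //=; rewrite gnorm0.
Qed.

(** A box is bounded, every entry being controlled by the corners [lo] and [hi], so the operator
    norms on it have a genuine supremum. *)
Lemma opnorm_le_set_norm (B S : set 'M[R]_(k, l)) A :
  is_enclosure B S -> B A -> opnorm N N' A <= set_norm (opnorm N N') B.
Proof.
move=> [lo [hi [-> _]]] BA; apply: ub_le_sup; last by exists A.
have [C C0 hC] := opnorm_bound.
exists (C * (`|lo| + `|hi|)) => _ [M /= BM <-]; apply: opnorm_le => x Nx.
apply: le_trans (hC M x Nx) _; rewrite ler_wpM2l //; apply: mx_norm_le.
  by rewrite addr_ge0.
move=> i j; have /andP[h1 h2] := BM i j; rewrite ler_norml; apply/andP; split.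
  rewrite lerNl; apply: (@le_trans _ _ `|lo|); last by rewrite lerDl.
  apply: le_trans (mx_entry_le lo i j); rewrite -normrN.
  by apply: le_trans (ler_norm _); rewrite lerN2.
apply: (@le_trans _ _ `|hi|); last by rewrite lerDr.
by apply: le_trans (mx_entry_le hi i j); apply: le_trans h2 (ler_norm _).
Qed.

End OperatorNorms.

(** * The contraction principle and the constants of the Newton map *)

Section FixedPoint.
Context {R : realType}.

(* A minimiser of the displacement [N (T x - x)] over the compact ball is
   fixed. *)
Lemma contraction_fixed_point u (N : 'rV[R]_u -> R) (T : 'rV[R]_u -> 'rV[R]_u)
    (p : 'rV[R]_u) (rho q : R) :
  is_norm N -> 0 <= rho -> q < 1 ->
  (forall x, N (x - p) <= rho -> N (T x - p) <= rho) ->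
  (forall x x', N (x - p) <= rho -> N (x' - p) <= rho ->
    N (T x - T x') <= q * N (x - x')) ->
  exists2 x, N (x - p) <= rho & T x = x.
Proof.
move=> hN rho0 q1 Tball Tlip; pose K := [set x | N (x - p) <= rho].
have [C C0 hC] := mx_le_gnorm hN; have [C' C'0 hC'] := gnorm_le_mx hN.
have cK : compact K.
  apply: bounded_closed_compact.
    exists (`|p| + C * rho); split; first exact: num_real.
    move=> M hM x Kx; apply: le_trans (ltW hM).
    rewrite -[x](subrK p) addrC; apply: le_trans (ler_normD _ _) _.
    by rewrite lerD2l; apply: le_trans (hC _) _; rewrite ler_pM2l.
  rewrite (_ : K = (fun x => N (x - p)) @^-1` [set t | t <= rho]) //.
  apply: closed_comp; last exact: closed_le.
    move=> x _; apply: (@continuous_comp 'rV[R]_u 'rV[R]_u R (fun x => x - p) N x).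
      by apply: differentiable_continuous.
    exact: (gnorm_continuous hN).
have cF : {within K, continuous (fun x => N (T x - x))}.
  apply/subspace_continuousP => x Kx; apply/(@cvgrPdist_le R R^o) => e e0.
  (* The displacement changes by at most N (T a - T b) + N (a - b), hence by at most twice N (a -
     b); [C'] passes from N to the sup norm. *)
  have ec : 0 < e / (2 * C') by rewrite divr_gt0 // mulr_gt0.
  apply: filterS (nbhsx_ballx x _ ec) => y; rewrite -ball_normE => /ltW /= xy Ky.
  have q0 z : q * N z <= N z by rewrite ler_piMl ?gnorm_ge0 // ltW.
  have key a b : K a -> K b -> `|a - b| <= e / (2 * C') ->
      N (T a - a) <= N (T b - b) + e.
    move=> Ka Kb ab; apply: le_trans (gnorm_le_add hN _ (T b - b)) _.
    rewrite lerD2l (_ : _ - _ = (T a - T b) - (a - b)); last first.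
      by rewrite !opprB [LHS]addrACA [RHS]addrACA [- a - _]addrC.
    apply: le_trans (gnormD hN _ _) _; rewrite gnormN //.
    apply: (@le_trans _ _ (2 * (C' * (e / (2 * C'))))); last first.
      by rewrite mulrA mulrCA mulfV ?mulr1 // gt_eqF // mulr_gt0.
    rewrite mulr_natl mulr2n; apply: lerD.
      apply: le_trans (Tlip a b Ka Kb) _; apply: le_trans (q0 _) _.
      by apply: le_trans (hC' _) _; rewrite ler_pM2l.
    by apply: le_trans (hC' _) _; rewrite ler_pM2l.
  rewrite ler_distl; apply/andP; split.
    by rewrite lerBlDr key // distrC.
  exact: key.
have Kp : K p by rewrite /K /= subrr gnorm0.
have [c] := EVT_min_rV (ex_intro _ p Kp) cK cF; rewrite inE => Kc cmin.
exists c => //; apply: contrapT => /eqP; rewrite -subr_eq0 => /eqP Tc.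
have Nc : 0 < N (T c - c).
  rewrite lt_neqAle gnorm_ge0 // andbT eq_sym; apply/eqP => /(gnorm_eq0 hN).
  exact: Tc.
have KTc : K (T c) by exact: Tball.
have := cmin (T c); rewrite inE => /(_ KTc); apply/negP; rewrite -ltNge.
by apply: le_lt_trans (Tlip _ _ KTc Kc) _; rewrite gtr_pMl.
Qed.

(* [B] is the inverse of [A] when [0 < k], and the conclusion bounds the two
   contributions to the Newton map [x - g x *m B]. *)
Lemma preconditioner u k (N : 'rV[R]_u -> R) (N1 : 'rV[R]_k -> R)
    (P : 'M[R]_(u, k)) (A : 'M[R]_k) (Delta S : set 'M[R]_(u, k)) (b r : R) :
  is_norm N -> is_norm N1 -> is_enclosure Delta S -> Delta !=set0 ->
  0 < r -> 0 <= b ->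
  ((0 < k)%N ->
    min_expansion N1 A * r > b + set_norm (opnorm N N1) Delta * r) ->
  exists (B : 'M[R]_k) (q be : R),
    [/\ B \in unitmx, 0 <= q < 1, be + q * r < r,
        forall w, N1 w <= b -> N1 (w *m B) <= be
      & forall M h, Delta (M - P *m A) -> N1 (h *m P - h *m M *m B) <= q * N h].
Proof.
(* For k = 0 the inequality is absent; all vectors of length 0 vanish, so the identity with both
   constants 0 works. *)
move=> hN hN1 hE [D0 DD0] r0 b0; have [k0 _|k0 /(_ isT)] := posnP k.
  have N10 w : N1 w = 0.
    rewrite (_ : w = 0) ?gnorm0 //; apply/rowP => j.
    by have := ltn_ord j; rewrite [X in (_ < X)%N]k0.
  exists 1%:M, 0, 0; split; rewrite ?unitmx1 ?mul0r ?addr0 ?lexx ?ltr01 //.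
    by move=> w _; rewrite N10.
  by move=> M h _; rewrite N10 mul0r.
set D := set_norm _ _ => hm.
have D_ge0 : 0 <= D.
  exact: le_trans (opnorm_ge0 hN hN1 D0) (opnorm_le_set_norm hN hN1 hE DD0).
(* The right-hand side is nonnegative, so the strict inequality excludes the value 0 that
   [min_expansion] takes on singular matrices. *)
have m0 : 0 < min_expansion N1 A.
  rewrite -(pmulr_lgt0 _ r0); apply: le_lt_trans hm.
  by rewrite addr_ge0 // mulr_ge0 // ltW.
move: m0 hm; rewrite /min_expansion; case: ifPn => [detA|]; last by rewrite ltxx.
set ka := opnorm _ _ _; rewrite invr_gt0 => ka0 hm.
have uA : A \in unitmx by rewrite unitmxE unitfE.
have hlt : ka * b + ka * D * r < r.
  by rewrite -mulrA -mulrDr -ltr_pdivlMl.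
(* With [ka] the norm of the inverse of A, [hlt] is the hypothesis multiplied by [ka], that is, be +
   q r < r for these q and be. *)
exists (invmx A), (ka * D), (ka * b); split => //.
- by rewrite unitmx_inv.
- rewrite mulr_ge0 ?(ltW ka0) //= -(ltr_pM2r r0) mul1r; apply: le_lt_trans hlt.
  by rewrite lerDr mulr_ge0 // ltW.
- move=> w wb; apply: le_trans (le_opnorm hN1 hN1 _ _) _.
  by rewrite ler_pM2l.
- move=> M h hM.
  have -> : h *m P - h *m M *m invmx A = - (h *m (M - P *m A) *m invmx A).
    by rewrite mulmxBr mulmxBl opprB -!mulmxA mulmxV // mulmx1.
  rewrite gnormN //; apply: le_trans (le_opnorm hN1 hN1 _ _) _.
  rewrite -mulrA ler_pM2l //; apply: le_trans (le_opnorm hN hN1 _ _) _.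
  apply: ler_wpM2r; [exact: gnorm_ge0|exact: opnorm_le_set_norm hE hM].
Qed.

End FixedPoint.

(** * One-sided derivatives in the parameter, and mean value theorems in x and in e *)

Section MeanValue.
Context {R : realType}.

(** Restricting a two-sided limit to E preserves it, and properness of the restricted filter makes
    it the only limit. One-sided derivatives are thereby computed on an extension. *)
Lemma derive_within_eq (V : normedModType R) (E : set R) (phi psi : R -> V) e :
  ProperFilter (within E (e^')) -> E e -> (forall t, E t -> phi t = psi t) ->
  derivable psi e 1 -> derive_within E phi e = 'D_1 psi e.
Proof.
move=> PF Ee phipsi dpsi; apply: cvg_lim => //.
have d0 : h^-1 *: (psi (h *: 1 + e) - psi e) @[h --> 0^'] --> 'D_1 psi e := dpsi.
have d1 : (s - e)^-1 *: (psi s - psi e) @[s --> e^'] --> 'D_1 psi e.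
  apply/cvgrPdist_lt => c c0; have /cvgrPdist_lt /(_ c c0) := d0.
  move=> [d /= dpos hd]; exists d => //= s; rewrite /ball_ /= => es sne.
  have := hd (s - e); rewrite /ball_ /= sub0r normrN distrC => /(_ es).
  rewrite subr_eq0 => /(_ sne); rewrite (_ : (s - e) *: 1 + e = s) //.
  by rewrite [_ *: _]mulr1 subrK.
have d2 : (s - e)^-1 *: (psi s - psi e) @[s --> within E (e^')] --> 'D_1 psi e.
  exact: cvg_within_filter d1.
apply: cvg_trans d2; apply: near_eq_cvg; near=> s.
by rewrite !phipsi //; near: s; exact: withinT.
Unshelve. all: by end_near. Qed.

(** Each point of a nondegenerate segment, end points included, is a limit of other points of the
    segment; this gives uniqueness of the limit in [derive_within]. *)
Lemma within_segment_proper (a b e : R) :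
  a < b -> a <= e <= b -> ProperFilter (within [set t | a <= t <= b] (e^')).
Proof.
move=> ab /andP[ae eb]; apply: Build_ProperFilter_ex => A /= [d /= d0 hd].
have [eb'|be] := ltP e b.
  pose h := Num.min (d / 2) (b - e).
  have h0 : 0 < h by rewrite lt_min divr_gt0 //= subr_gt0.
  have hb : h <= b - e by rewrite ge_min lexx orbT.
  exists (e + h); apply: hd => /=.
  - rewrite opprD addNKr normrN gtr0_norm // gt_min.
    by rewrite ltr_pdivrMr // ltr_pMr // ltr1n.
  - by rewrite -subr_eq0 addrAC subrr add0r gt_eqF.
  - rewrite -lerBrDl hb andbT; apply: le_trans ae _; by rewrite lerDl ltW.
pose h := Num.min (d / 2) (e - a).
have h0 : 0 < h by rewrite lt_min divr_gt0 //= subr_gt0 (lt_le_trans ab).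
have ha : h <= e - a by rewrite ge_min lexx orbT.
exists (e - h); apply: hd => /=.
- rewrite opprB addrC subrK gtr0_norm // gt_min.
  by rewrite ltr_pdivrMr // ltr_pMr // ltr1n.
- by rewrite -subr_eq0 addrAC subrr add0r oppr_eq0 gt_eqF.
- rewrite lerBrDl addrC -lerBrDl ha /=; apply: le_trans eb; by rewrite gerBl ltW.
Qed.

(* The columns of [M] are Jacobian columns at different points. *)
Lemma mean_value_mx u k (f : 'rV[R]_u -> 'rV[R]_k) (U : set 'rV[R]_u) x x' :
  (forall z, U z -> differentiable f z) ->
  (forall t, 0 <= t <= 1 -> U (x' + t *: (x - x'))) ->
  exists M : 'M[R]_(u, k), f x - f x' = (x - x') *m M /\
    forall j, exists2 z, U z & forall i, M i j = 'J f z i j.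
Proof.
move=> df seg; pose c (t : R) := x' + t *: (x - x').
have dc (t : R^o) : is_diff t (cst x' + *:%R^~ (x - x')) (0 + *:%R^~ (x - x')).
  exact: is_diffD.
have cE : (c : R^o -> 'rV[R]_u) = cst x' + *:%R^~ (x - x') by [].
have ddc (t : R) : differentiable (c : R^o -> 'rV[R]_u) (t : R^o).
  by rewrite cE; case: (dc t).
have Dc (t : R) : 'D_1 (c : R^o -> 'rV[R]_u) t = x - x'.
  rewrite (deriveE _ (ddc t)) cE; case: (dc t) => _ ->.
  by rewrite fctE scale1r add0r.
have key j : exists2 z, U z & f x 0 j - f x' 0 j = ((x - x') *m 'J f z) 0 j.
  pose phi (t : R) := f (c t) 0 j.
  have dphi (t : R) : 0 <= t <= 1 ->
      is_derive (t : R^o) (1 : R^o) (phi : R^o -> R^o) (((x - x') *m 'J f (c t)) 0 j).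
    move=> t01; have dfc := df _ (seg t t01).
    have dfct : differentiable (f \o c) t by exact: differentiable_comp.
    split.
      by have /derivable_mxP /(_ 0 j) := diff_derivable (v := 1 : R^o) dfct.
    have := derive_mx (diff_derivable (v := 1 : R^o) dfct).
    move=> /(congr1 (fun M : 'rV[R]_k => M 0 j)).
    rewrite mxE => <-; rewrite deriveE // diff_comp //=.
    by rewrite -(deriveE (1 : R^o) (ddc t)) Dc -deriveE // deriveEjacobian.
  have cphi : {within `[0, 1], continuous phi}.
    by apply: derivable_within_continuous => t; rewrite in_itv /= => /dphi [].
  have [t|t] := @MVT R phi (fun t => ((x - x') *m 'J f (c t)) 0 j) 0 1 ltr01 _ cphi.
    by rewrite in_itv /= => /andP[t0 t1]; apply: dphi; rewrite !ltW.
  rewrite in_itv /= => /andP[t0 t1]; rewrite subr0 mulr1 => E.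
  exists (c t); first by apply: seg; rewrite !ltW.
  by rewrite -E /phi /c scale1r scale0r addr0 [x' + _]addrC subrK.
have /choice [z hz] (j : 'I_k) : exists z, U z /\
    f x 0 j - f x' 0 j = ((x - x') *m 'J f z) 0 j.
  by have [z Uz hz] := key j; exists z.
exists (\matrix_(i, j) 'J f (z j) i j); split.
  apply/rowP => j; transitivity (f x 0 j - f x' 0 j); first by rewrite !mxE.
  have [_ ->] := hz j; rewrite mxE [RHS]mxE; apply: eq_bigr => i _.
  by congr (_ * _); rewrite [RHS]mxE.
by move=> j; exists (z j) => [|i]; [have [] := hz j|rewrite [LHS]mxE].
Qed.

Lemma diff_pairl (V W : normedModType R) (a : V) (x : W) :
  differentiable (fun z : W => (a, z)) x /\
  forall v, 'd (fun z : W => (a, z)) x v = (0, v).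
Proof.
have [d D] : is_diff x (fun z => (cst a z, id z)) (fun v => ((0 : W -> V) v, id v)).
  exact: is_diff_pair.
by split=> [|v]; [exact: d|rewrite D].
Qed.

Lemma diff_pairr (V W : normedModType R) (a : V) (x : W) :
  differentiable (fun z : W => (z, a)) x /\
  forall v, 'd (fun z : W => (z, a)) x v = (v, 0).
Proof.
have [d D] : is_diff x (fun z => (id z, cst a z)) (fun v => (id v, (0 : W -> V) v)).
  exact: is_diff_pair.
by split=> [|v]; [exact: d|rewrite D].
Qed.

Lemma mx_entry_delta (k l : nat) (A : 'M[R]_(k, l)) i j :
  A i j = ((delta_mx 0 i : 'rV_k) *m A) 0 j.
Proof. by rewrite -rowE mxE. Qed.

Section Family.
Context {u k : nat} {eps0 : R} {E : set R} {U : set 'rV[R]_u}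
  {y : R -> 'rV[R]_u -> 'rV[R]_k}.
Hypotheses (eps0_gt0 : 0 < eps0) (hE : E = [set e | 0 <= e <= eps0])
  (hU : open U).
Hypothesis hy : Ck_on 2 (fun t : R^o * 'rV[R]_u => y t.1 t.2) (E `*` U).

(** For fixed e the map [y e] agrees with g(e, .) on U, which is open, so its Jacobian entries are
    partial derivatives of g. Both later mean value arguments in e work with g through this
    identification. *)
Lemma slice_differentiable : exists (G : set (R^o * 'rV[R]_u))
    (g : R^o * 'rV[R]_u -> 'rV[R]_k),
  [/\ open G, E `*` U `<=` G, Ck 2 g G,
      forall e x, E e -> U x -> y e x = g (e, x)
    & forall e x, E e -> U x -> differentiable (y e) x /\
        forall i j, 'J (y e) x i j = 'D_(0, delta_mx 0 i) g (e, x) 0 j].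
Proof.
have [G [g [oG EUG gC yg]]] := hy; exists G, g; split => // [e x Ee Ux|e x Ee Ux].
  exact: (yg (e, x)).
have dg : differentiable g (e, x) by apply: gC.1; exact: EUG.
have [dp Dp] := diff_pairl (e : R^o) x.
have dgx : differentiable (g \o (fun z => (e : R^o, z))) x.
  exact: differentiable_comp.
have [|dy Dy] := near_eq_differentiable (f := g \o (fun z => (e : R^o, z)))
    (g := y e) _ dgx.
  by apply: near_eq_open hU _ Ux => z Uz /=; rewrite (yg (e, z)).
split=> [|i j]; first exact: dy.
rewrite mx_entry_delta.
rewrite -(deriveEjacobian _ dy) (deriveE _ dy) Dy (diff_comp dp dg) (deriveE _ dg) /comp.
by rewrite Dp.
Qed.

Let E_proper e : E e -> ProperFilter (within E (e^')).
Proof. by rewrite hE; exact: within_segment_proper. Qed.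

(** [y 0] vanishes on the open set U, hence so does its Jacobian, and the entry at e is the
    increment over [0, e] of a scalar function, differentiable because g is C^2. The point tau
    depends on the entry. *)
Lemma mixed_mean_value e x i j : E e -> U x -> (forall z, U z -> y 0 z = 0) ->
  exists2 tau, E tau &
    'J (y e) x i j = e * derive_within E (fun t => 'J (y t) x) tau i j.
Proof.
move=> Ee Ux y0; have [G [g [oG EUG gC yg Jg]]] := slice_differentiable.
pose F (t : R) := \matrix_(i, j) ('D_(0, delta_mx 0 i) g (t, x) 0 j).
have JF t : E t -> 'J (y t) x = F t.
  by move=> Et; apply/matrixP => i' j'; rewrite [RHS]mxE; exact: (Jg t x Et Ux).2.
have dF t : E t -> derivable (F : R^o -> _) t 1.
  move=> Et; apply/derivable_mxP => i' j'.
  have [dp _] := diff_pairr x (t : R^o).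
  have dD : differentiable ('D_(0, delta_mx 0 i') g) (t : R^o, x).
    by apply: (gC.2 _).1; exact: EUG.
  have dc : differentiable ('D_(0, delta_mx 0 i') g \o (fun s : R^o => (s, x)))
      (t : R^o) by exact: differentiable_comp.
  have -> : (fun s => F s i' j') =
      (fun s => ('D_(0, delta_mx 0 i') g \o (fun s : R^o => (s, x))) s 0 j').
    by apply/funext => s; exact: mxE.
  exact: ((derivable_mxP _ _ _).1 (diff_derivable dc)).
have J0 : 'J (y 0) x = 0.
  have E0 : E 0 by rewrite hE /= lexx ltW.
  have d0 : differentiable (cst 0 : 'rV[R]_u -> 'rV[R]_k) x.
    exact: differentiable_cst.
  have [|_ D0] := near_eq_differentiable (g := y 0) _ d0.
    by apply: near_eq_open hU _ Ux => z Uz; rewrite y0.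
  apply/row_matrixP => l; rewrite row0 rowE -deriveEjacobian.
    by rewrite (deriveE _ (Jg 0 x E0 Ux).1) D0 diff_cst.
  exact: (Jg 0 x E0 Ux).1.
have e0 : 0 <= e by move: Ee; rewrite hE => /andP[].
have sub t : t \in `[0, e] -> E t.
  rewrite in_itv hE /= => /andP[-> te] /=; apply: le_trans te _.
  by move: Ee; rewrite hE => /andP[].
have [tau||tau taue h] := @MVT_segment R (fun t => F t i j)
    (fun t => ('D_1 (F : R^o -> _) t) i j) 0 e e0 _ _.
- rewrite in_itv /= => /andP[t0 t1].
  have dFt : derivable (F : R^o -> _) tau 1.
    by apply: dF; apply: sub; rewrite in_itv /= !ltW.
  by split; [have /derivable_mxP := dFt; exact|rewrite derive_mx // mxE].
- apply: derivable_within_continuous => t /sub Et.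
  by have /derivable_mxP := dF t Et; exact.
exists tau; first exact: sub.
rewrite (derive_within_eq (E_proper (sub _ taue)) (sub _ taue) JF (dF _ (sub _ taue))).
have E0 : E 0 by rewrite hE /= lexx ltW.
move: h; rewrite subr0 mulrC => <-.
by rewrite -JF // -JF // J0 [X in _ - X]mxE subr0.
Qed.

(** The derivative in e is continuous on the compact interval E, so the supremum b is a true bound
    for its norm; the mean value inequality for N on [0, e] then applies. *)
Lemma time_mean_value (N : 'rV[R]_k -> R) p e : is_norm N -> U p -> E e ->
  let b := set_norm N [set derive_within E (fun t => y t p) t | t in E] in
  0 <= b /\ N (y e p - y 0 p) <= b * e.
Proof.
move=> hN Up Ee b; have [G [g [oG EUG gC yg _]]] := slice_differentiable.
pose F (t : R) := g (t : R^o, p).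
have dF t : E t -> derivable (F : R^o -> _) t 1 /\
    'D_1 (F : R^o -> _) t = 'D_(1, 0) g (t, p).
  move=> Et; have dg : differentiable g (t : R^o, p) by apply: gC.1; exact: EUG.
  have [dp Dp] := diff_pairr p (t : R^o).
  have dc : differentiable (g \o (fun s : R^o => (s, p))) (t : R^o).
    exact: differentiable_comp.
  split; first exact: diff_derivable.
  by rewrite (deriveE _ dc) (diff_comp dp dg) (deriveE _ dg) /comp Dp.
have DE t : E t -> derive_within E (fun t => y t p) t = 'D_(1, 0) g (t, p).
  move=> Et; rewrite -(dF t Et).2; apply: derive_within_eq => //.
  - exact: E_proper.
  - by move=> s Es; rewrite yg.
  - exact: (dF t Et).1.
have sub t : t \in `[0, eps0] -> E t by rewrite in_itv hE.
have cN : {within `[0, eps0], continuous (fun t : R => N ('D_(1, 0) g (t : R^o, p)))}.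
  apply/continuous_in_subspaceT => t; rewrite inE => /sub Et.
  apply: (@continuous_comp R^o 'rV[R]_k R (fun t => 'D_(1, 0) g (t, p)) N t).
    apply: (@continuous_comp R^o (R^o * 'rV[R]_u)%type 'rV[R]_k
      (fun t => (t, p)) ('D_(1, 0) g) t).
      exact: (differentiable_continuous (diff_pairr p (t : R^o)).1).
    exact: (@Ck_continuous _ 1 _ _ _ _ _ (gC.2 _) (EUG (t : R^o, p) (conj Et Up))).
  exact: (gnorm_continuous hN).
have le_b t : E t -> N ('D_(1, 0) g (t, p)) <= b.
  move=> Et; apply: ub_le_sup; last first.
    by exists (derive_within E (fun t => y t p) t); [exists t|rewrite DE].
  have [c _ cmax] := EVT_max (ltW eps0_gt0) cN.
  exists (N ('D_(1, 0) g (c, p))) => _ [_ [s Es <-] <-].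
  by rewrite DE //; apply: cmax; move: Es; rewrite hE in_itv.
split; first by apply: le_trans (le_b e Ee); exact: gnorm_ge0.
have E0 : E 0 by rewrite hE /= lexx ltW.
have /andP[e0 ee] : 0 <= e <= eps0 by move: Ee; rewrite hE.
rewrite !yg // -[e in leRHS]subr0; apply: (gnorm_mean_value hN e0 (psi := F)) => t.
rewrite in_itv /= => /andP[t0 te].
have Et : E t by rewrite hE /= t0 (le_trans te).
by have [dFt ->] := dF t Et; split => //; exact: le_b.
Qed.

End Family.
End MeanValue.

(** * The zero of y(e, .) and the invertibility of its Jacobian *)

Section NondegenerateZero.
Context {R : realType}.

(** Membership in a product of intervals is tested entry by entry, so the intermediate points of the
    mean value theorems may differ between entries. *)
Lemma enclosure_entrywise k l (B S : set 'M[R]_(k, l)) (M : 'M[R]_(k, l)) :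
  is_enclosure B S -> (forall i j, exists2 A, S A & M i j = A i j) -> B M.
Proof.
move=> [lo [hi [-> SB]]] h i j; have [A SA ->] := h i j; exact: (SB A SA).
Qed.

Lemma jacobian_linear_comp u k l (f : 'rV[R]_u -> 'rV[R]_k)
    (L : {linear 'rV[R]_k -> 'rV[R]_l}) x v :
  differentiable f x -> v *m 'J (L \o f) x = L (v *m 'J f x).
Proof.
move=> df; have Lc : continuous L by apply/framed_linear_continuous/framed_rV.
have [dLf D] := differentiable_linear_comp Lc df.
by rewrite -!deriveEjacobian.
Qed.

Lemma norm_ball_segment u (N : 'rV[R]_u -> R) p r x x' t : is_norm N ->
  norm_ball N p r x -> norm_ball N p r x' -> 0 <= t <= 1 ->
  norm_ball N p r (x' + t *: (x - x')).
Proof.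
rewrite /norm_ball /= => hN Ux Ux' /andP[t0 t1].
have -> : x' + t *: (x - x') - p = (1 - t) *: (x' - p) + t *: (x - p).
  by apply/rowP => i; rewrite !mxE; ring.
apply: le_lt_trans (gnormD hN _ _) _; rewrite !gnormZ //.
rewrite ger0_norm ?subr_ge0 // (ger0_norm t0).
have [->|tn0] := eqVneq t 0; first by rewrite subr0 mul1r mul0r addr0.
have tp : 0 < t by rewrite lt_neqAle eq_sym tn0.
rewrite [ltRHS](_ : r = (1 - t) * r + t * r); last by ring.
apply: ler_ltD.
  by rewrite ler_wpM2l ?subr_ge0 // ltW.
by rewrite ltr_pM2l.
Qed.

Lemma row_mxB k1 k2 (a a' : 'rV[R]_k1) (b b' : 'rV[R]_k2) :
  row_mx a b - row_mx a' b' = row_mx (a - a') (b - b').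
Proof. by rewrite opp_row_mx add_row_mx. Qed.

Lemma sub_row_mx k1 k2 (h : 'rV[R]_(k1 + k2)) a b :
  row_mx (lsubmx h - a) (rsubmx h - b) = h - row_mx a b.
Proof. by rewrite -row_mxB hsubmxK. Qed.

Lemma nondegenerate_zero k1 k2 (eps0 : R) (E : set R)
    (N1 : 'rV[R]_k1 -> R) (N2 : 'rV[R]_k2 -> R) (p : 'rV[R]_(k1 + k2)) (r : R)
    (U : set 'rV[R]_(k1 + k2)) (y : R -> 'rV[R]_(k1 + k2) -> 'rV[R]_(k1 + k2))
    (A11 : 'M[R]_k1) (A22 : 'M[R]_k2)
    (Delta1 : set 'M[R]_(k1 + k2, k1)) (Delta2 : set 'M[R]_(k1 + k2, k2)) :
  let y1 := fun e x => lsubmx (y e x) in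
  let y2 := fun e x => rsubmx (y e x) in
  let N := max_norm N1 N2 in
  0 < eps0 -> E = [set e | 0 <= e <= eps0] -> is_norm N1 -> is_norm N2 ->
  0 < r -> open U -> U = norm_ball N p r ->
  Ck_on 2 (fun t : R^o * 'rV[R]_(k1 + k2) => y t.1 t.2) (E `*` U) ->
  y1 0 p = 0 -> (forall x, U x -> y2 0 x = 0) ->
  is_enclosure Delta1 [set 'J (y1 t.1) t.2 - col_mx A11 0 | t in E `*` U] ->
  is_enclosure Delta2
    [set derive_within E (fun e => 'J (y2 e) t.2) t.1 - col_mx 0 A22
      | t in E `*` U] ->
  ((0 < k1)%N -> min_expansion N1 A11 * r >
    eps0 * set_norm N1 [set derive_within E (fun t => y1 t p) e | e in E]
    + set_norm (opnorm N N1) Delta1 * r) ->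
  ((0 < k2)%N -> min_expansion N2 A22 * r >
    set_norm N2 [set derive_within E (fun t => y2 t p) e | e in E]
    + set_norm (opnorm N N2) Delta2 * r) ->
  forall e, 0 < e <= eps0 -> exists x,
    [/\ U x, y e x = 0, differentiable (y e) x & 'J (y e) x \in unitmx].
Proof.
move=> y1 y2 N eps0_gt0 hE hN1 hN2 r0 oU hU yC y1p y20 hD1 hD2 hi1 hi2 e.
move=> /andP[e0 eeps]; have hN : is_norm N by exact: max_norm_is_norm.
have Ee : E e by rewrite hE /= (ltW e0).
have Up : U p by rewrite hU /norm_ball /= subrr gnorm0.
have frU := framed_rV (R := R) (k1 + k2).
have y1C : Ck_on 2 (fun t : R^o * 'rV[R]_(k1 + k2) => y1 t.1 t.2) (E `*` U).
  exact: (Ck_on_linear_comp lsubmx frU yC).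
have y2C : Ck_on 2 (fun t : R^o * 'rV[R]_(k1 + k2) => y2 t.1 t.2) (E `*` U).
  exact: (Ck_on_linear_comp rsubmx frU yC).
have dye x : U x -> differentiable (y e) x.
  by have [G [g [_ _ _ _ h]]] := slice_differentiable oU yC => /(h e x Ee) [].
have dy1 x : U x -> differentiable (y1 e) x.
  by have [G [g [_ _ _ _ h]]] := slice_differentiable oU y1C => /(h e x Ee) [].
have dy2 x : U x -> differentiable (y2 e) x.
  by have [G [g [_ _ _ _ h]]] := slice_differentiable oU y2C => /(h e x Ee) [].
have [b1_ge0 b1_le] := time_mean_value eps0_gt0 hE oU y1C hN1 Up Ee.
have [b2_ge0 b2_le] := time_mean_value eps0_gt0 hE oU y2C hN2 Up Ee.
set b1 := set_norm N1 _ in b1_ge0 b1_le hi1.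
set b2 := set_norm N2 _ in b2_ge0 b2_le hi2.
rewrite y1p subr0 in b1_le; rewrite (y20 p Up) subr0 in b2_le.
(* The two block projections as matrices; the products with [A11] and [A22] are the block matrices
   subtracted in the definition of the enclosures. *)
pose P1 : 'M[R]_(k1 + k2, k1) := col_mx 1%:M 0.
pose P2 : 'M[R]_(k1 + k2, k2) := col_mx 0 1%:M.
have P1E h : h *m P1 = lsubmx h.
  by rewrite -[h in LHS]hsubmxK mul_row_col mulmx1 mulmx0 addr0.
have P2E h : h *m P2 = rsubmx h.
  by rewrite -[h in LHS]hsubmxK mul_row_col mulmx1 mulmx0 add0r.
have P1A : P1 *m A11 = col_mx A11 0 by rewrite mul_col_mx mul1mx mul0mx.
have P2A : P2 *m A22 = col_mx 0 A22 by rewrite mul_col_mx mul1mx mul0mx.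
have box1 (M : 'M[R]_(k1 + k2, k1)) :
    (forall j, exists2 z, U z & forall i, M i j = 'J (y1 e) z i j) ->
    Delta1 (M - P1 *m A11).
  move=> hM; apply: (enclosure_entrywise hD1) => i j; have [z Uz hz] := hM j.
  exists ('J (y1 e) z - col_mx A11 0); first by exists (e, z).
  by rewrite P1A mxE hz [RHS]mxE.
have box2 (M : 'M[R]_(k1 + k2, k2)) :
    (forall j, exists2 z, U z & forall i, M i j = 'J (y2 e) z i j) ->
    Delta2 (e^-1 *: M - P2 *m A22).
  move=> hM; apply: (enclosure_entrywise hD2) => i j; have [z Uz hz] := hM j.
  (* Each entry of M is e times a mixed derivative at some tau in E, so the factor 1/e brings it
     into the range of [Delta2]. *)
  have [tau Et ht] := mixed_mean_value eps0_gt0 hE oU y2C i j Ee Uz y20.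
  exists (derive_within E (fun t => 'J (y2 t) z) tau - col_mx 0 A22).
    by exists (tau, z).
  by rewrite P2A mxE mxE hz ht mulKf ?gt_eqF // [RHS]mxE.
have D1p := box1 ('J (y1 e) p) (fun j => ex_intro2 _ _ p Up (fun i => erefl)).
have D2p := box2 ('J (y2 e) p) (fun j => ex_intro2 _ _ p Up (fun i => erefl)).
have [B1 [q1 [be1 [uB1 /andP[q1_ge0 q1_lt1] hb1 hB1 hq1]]]] :=
  preconditioner P1 hN hN1 hD1 (ex_intro _ _ D1p) r0
    (mulr_ge0 (ltW eps0_gt0) b1_ge0) hi1.
have [B2 [q2 [be2 [uB2 /andP[q2_ge0 q2_lt1] hb2 hB2 hq2]]]] :=
  preconditioner P2 hN hN2 hD2 (ex_intro _ _ D2p) r0 b2_ge0 hi2.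
pose g2 x := e^-1 *: y2 e x.
have g1p : N1 (y1 e p *m B1) <= be1.
  by apply: hB1; apply: le_trans b1_le _; rewrite mulrC ler_wpM2r.
have g2p : N2 (g2 p *m B2) <= be2.
  apply: hB2; rewrite gnormZ // gtr0_norm ?invr_gt0 //.
  by rewrite ler_pdivrMl // mulrC.
have seg x x' : U x -> U x' -> forall t, 0 <= t <= 1 -> U (x' + t *: (x - x')).
  by rewrite hU => Ux Ux' t; exact: norm_ball_segment.
have inc1 x x' : U x -> U x' ->
    N1 ((x - x') *m P1 - (y1 e x - y1 e x') *m B1) <= q1 * N (x - x').
  move=> Ux Ux'; have [M [-> hM]] := mean_value_mx dy1 (seg x x' Ux Ux').
  by apply: hq1; exact: box1.
have inc2 x x' : U x -> U x' ->
    N2 ((x - x') *m P2 - (g2 x - g2 x') *m B2) <= q2 * N (x - x').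
  move=> Ux Ux'; have [M [hM1 hM]] := mean_value_mx dy2 (seg x x' Ux Ux').
  by rewrite /g2 -scalerBr hM1 scalemxAr; apply: hq2; exact: box2.
pose q := Num.max q1 q2; have q1q : q < 1 by rewrite gt_max q1_lt1.
have le_qN a b v : N1 (lsubmx v) <= q1 * a -> N2 (rsubmx v) <= q2 * a -> 0 <= a ->
    b = q * a -> N v <= b.
  move=> h1 h2 a0 ->; rewrite /N /max_norm ge_max; apply/andP; split.
    by apply: le_trans h1 _; rewrite ler_wpM2r // le_max lexx.
  by apply: le_trans h2 _; rewrite ler_wpM2r // le_max lexx orbT.
pose T x := x - row_mx (y1 e x *m B1) (g2 x *m B2).
(* Displacement of p plus growth over distance at most r, in each block. Being strictly less than r,
   this radius gives a closed ball inside the open ball U. *)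
pose rho := Num.max (be1 + q1 * r) (be2 + q2 * r).
have rho_r : rho < r by rewrite gt_max hb1 hb2.
have rho0 : 0 <= rho.
  have be1_ge0 : 0 <= be1 := le_trans (gnorm_ge0 hN1 _) g1p.
  by rewrite le_max addr_ge0 // mulr_ge0 // ltW.
have inU x : N (x - p) <= rho -> U x.
  by move=> h; rewrite hU; exact: le_lt_trans rho_r.
have TB x x' : T x - T x' = row_mx ((x - x') *m P1 - (y1 e x - y1 e x') *m B1)
                             ((x - x') *m P2 - (g2 x - g2 x') *m B2).
  by rewrite P1E P2E !mulmxBl sub_row_mx -row_mxB /T opprB addrACA opprB
    [RHS]addrACA [- row_mx _ _ - _]addrC.
have Tp : T p + row_mx (y1 e p *m B1) (g2 p *m B2) = p by rewrite /T subrK.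
have [x xrho Tx] : exists2 x, N (x - p) <= rho & T x = x.
  apply: (contraction_fixed_point hN rho0 q1q) => [x xr|x x' xr xr'].
    have Ux := inU x xr; have xr' : N (x - p) <= r by exact: le_trans (ltW rho_r).
    have -> : T x - p = (T x - T p) - row_mx (y1 e p *m B1) (g2 p *m B2).
      by rewrite -[in LHS]Tp opprD addrA.
    rewrite TB row_mxB /N /max_norm row_mxKl row_mxKr.
    rewrite ge_max !le_max; apply/andP; split; apply/orP; [left|right].
      rewrite addrC; apply: le_trans (gnormD hN1 _ _) _; rewrite gnormN //.
      apply: lerD g1p _; apply: le_trans (inc1 x p Ux Up) _.
      by rewrite ler_wpM2l.
    rewrite addrC; apply: le_trans (gnormD hN2 _ _) _; rewrite gnormN //.
    apply: lerD g2p _; apply: le_trans (inc2 x p Ux Up) _.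
    by rewrite ler_wpM2l.
  have Ux := inU x xr; have Ux' := inU x' xr'.
  apply: (le_qN (N (x - x'))) => //; last exact: gnorm_ge0.
    by rewrite TB row_mxKl; exact: inc1.
  by rewrite TB row_mxKr; exact: inc2.
have Ux := inU x xrho; exists x; split => //; last 2 first.
- exact: dye.
(* For v in the kernel of the Jacobian the estimates [hq1] and [hq2] lose their second term and read
   N v <= q N v with q < 1. *)
- rewrite -row_free_unit; apply: inj_row_free => v vJ.
  have v1 : v *m 'J (y1 e) x = 0.
    by rewrite (jacobian_linear_comp lsubmx v (dye x Ux)) vJ linear0.
  have v2 : v *m 'J (y2 e) x = 0.
    by rewrite (jacobian_linear_comp rsubmx v (dye x Ux)) vJ linear0.
  have := hq1 _ v (box1 ('J (y1 e) x) (fun j => ex_intro2 _ _ x Ux (fun i => erefl))).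
  have := hq2 _ v (box2 ('J (y2 e) x) (fun j => ex_intro2 _ _ x Ux (fun i => erefl))).
  rewrite -scalemxAr v1 v2 scaler0 !mul0mx !subr0 P1E P2E => h2 h1.
  have Nv := le_qN (N v) _ v h1 h2 (gnorm_ge0 hN v) erefl.
  apply: (gnorm_eq0 hN); apply/le_anti; rewrite gnorm_ge0 // andbT.
  rewrite leNgt; apply/negP => Nv0; move: Nv; apply/negP; rewrite -ltNge.
  by rewrite gtr_pMl.
(* At a fixed point the Newton correction vanishes; since [B1], [B2] are invertible and e is
   nonzero, both components of y vanish. *)
have row0 : row_mx (y1 e x *m B1) (g2 x *m B2) = 0.
  by rewrite -[LHS](subKr x) -/(T x) Tx subrr.
move/eqP: row0; rewrite row_mx_eq0 => /andP[/eqP h1 /eqP h2].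
have y1x : y1 e x = 0 by rewrite -(mulmxK uB1 (y1 e x)) h1 mul0mx.
have g2x : g2 x = 0 by rewrite -(mulmxK uB2 (g2 x)) h2 mul0mx.
have y2x : y2 e x = 0.
  by apply: (scalerI (invr_neq0 (lt0r_neq0 e0))); rewrite scaler0.
by rewrite -[LHS]hsubmxK -/(y1 e x) -/(y2 e x) y1x y2x row_mx0.
Qed.

End NondegenerateZero.

(** * Tangent spaces of graphs in the coordinates (x, y, v, z) *)

Section Transversality.
Context {R : realType}.

Lemma diff_comp_apply (V W Z : normedModType R) (f : V -> W) (g : W -> Z) x v :
  differentiable f x -> differentiable g (f x) ->
  'd (g \o f) x v = 'd g (f x) ('d f x v).
Proof. by move=> df dg; rewrite diff_comp. Qed.

Lemma diff_linear_comp (V W Z : normedModType R) (L : {linear W -> Z})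
    (f : V -> W) x v :
  framed W -> differentiable f x -> 'd (L \o f) x v = L ('d f x v).
Proof.
move=> frW df; have Lc := framed_linear_continuous (L := L) frW.
have [dLf D] := differentiable_linear_comp Lc df.
by rewrite -(deriveE v dLf) D (deriveE v df).
Qed.

(** Reads off a component of a derivative from a graph equation that holds near the point. *)
Lemma diff_linear_near (V W Z : normedModType R) (L : {linear W -> Z})
    (f : V -> W) (g : V -> Z) x v :
  framed W -> differentiable f x -> differentiable g x ->
  {near x, L \o f =1 g} -> L ('d f x v) = 'd g x v.
Proof.
move=> frW df dg Lfg; have Lc := framed_linear_continuous (L := L) frW.
have [dLf _] := differentiable_linear_comp Lc df.
have [_ ->] := near_eq_differentiable Lfg dLf.
by rewrite diff_linear_comp.
Qed.

Lemma diff_id (V : normedModType R) (x : V) : 'd id x = id :> (V -> V).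
Proof. by case: (is_diff_id x). Qed.

Section Coordinates.
Context {u m c : nat}.
Local Notation coords := ('rV[R]_u * 'rV[R]_u * 'rV[R]_m * 'rV[R]_c)%type.

(** The coordinate projections with their linear structure, convertible to [prx], [pry], [prv] and
    [prz]. *)
Definition prx_lin : {linear coords -> 'rV[R]_u} := fst \o (fst \o fst).
Definition pry_lin : {linear coords -> 'rV[R]_u} := snd \o (fst \o fst).
Definition prv_lin : {linear coords -> 'rV[R]_m} := snd \o fst.
Definition prz_lin : {linear coords -> 'rV[R]_c} := snd.

Lemma coords_eq (t t' : coords) : prx t = prx t' -> pry t = pry t' ->
  prv t = prv t' -> prz t = prz t' -> t = t'.
Proof.
case: t => [[[x y] v] z]; case: t' => [[[x' y'] v'] z'].
by rewrite /prx /pry /prv /prz /= => -> -> -> ->.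
Qed.

Lemma framed_coords : framed coords.
Proof. by do ![apply: framed_prod]; exact: framed_rV. Qed.

(** By the chain rule, the derivative of h is a left inverse of that of chi. Identities between
    vectors can therefore be checked in coordinates. *)
Lemma local_coordinates_diff_inj n (O : set 'rV[R]_n) (chi : 'rV[R]_n -> coords) q :
  local_coordinates O chi -> O q -> injective ('d chi q).
Proof.
move=> [oO chiC ochi [h hC hchi]] Oq v w vw.
have dchi : differentiable chi q by apply: chiC.1.
have dh : differentiable h (chi q) by apply: hC.1; exists q.
have nid : {near q, h \o chi =1 id} by exact: near_eq_open oO hchi Oq.
have [_ D] := near_eq_differentiable nid (differentiable_comp dchi dh).
have inv v' : 'd h (chi q) ('d chi q v') = v'.
  rewrite -[LHS]/(('d h (chi q) \o 'd chi q) v') -(diff_comp dchi dh) -D diff_id.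
  reflexivity.
by rewrite -(inv v) vw inv.
Qed.

(* In the coordinates, the image of [F] is a graph over x inside [z = zst] and
   that of [Gm] a graph over (x, v, z); writing a vector as a sum of tangent
   vectors amounts to inverting the derivative of [y]. *)
Lemma graphs_transversal n (O : set 'rV[R]_n) (chi : 'rV[R]_n -> coords)
    (F : 'rV[R]_u -> 'rV[R]_n) (Gm : 'rV[R]_u * 'rV[R]_m * 'rV[R]_c -> 'rV[R]_n)
    (y : 'rV[R]_u -> 'rV[R]_u) (U : set 'rV[R]_u)
    (D : set ('rV[R]_u * 'rV[R]_m * 'rV[R]_c)) (x0 : 'rV[R]_u) (zst : 'rV[R]_c) :
  let kap x := (x, prv (chi (F x)), zst) in
  local_coordinates O chi -> open U -> open D ->
  (forall x, U x -> [/\ O (F x), prxz (chi (F x)) = row_mx x zst & D (kap x)]) ->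
  (forall t, D t -> O (Gm t) /\
    prxvz (chi (Gm t)) = row_mx (row_mx t.1.1 t.1.2) t.2) ->
  (forall x, U x -> y x = pry (chi (F x)) - pry (chi (Gm (kap x)))) ->
  U x0 -> differentiable F x0 -> differentiable Gm (kap x0) ->
  y x0 = 0 -> differentiable y x0 -> 'J y x0 \in unitmx ->
  F x0 = Gm (kap x0) /\
  forall w, exists xi tau, w = 'd F x0 xi + 'd Gm (kap x0) tau.
Proof.
move=> kap hchi oU oD hF hG hy Ux0 dF dG y0 dy Jy.
have [oO chiC _ [h hC hchi']] := hchi.
have [OF _ Dk] := hF x0 Ux0; have [OG Gk] := hG _ Dk.
have prxF x : U x -> prx (chi (F x)) = x.
  by move=> Ux; have [_ /eq_row_mx []] := hF x Ux.
have przF x : U x -> prz (chi (F x)) = zst.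
  by move=> Ux; have [_ /eq_row_mx []] := hF x Ux.
have prxG t : D t -> prx (chi (Gm t)) = t.1.1.
  by move=> Dt; have [_ /eq_row_mx [/eq_row_mx []]] := hG t Dt.
have prvG t : D t -> prv (chi (Gm t)) = t.1.2.
  by move=> Dt; have [_ /eq_row_mx [/eq_row_mx []]] := hG t Dt.
have przG t : D t -> prz (chi (Gm t)) = t.2.
  by move=> Dt; have [_ /eq_row_mx []] := hG t Dt.
have FG : F x0 = Gm (kap x0).
  (* The x, v and z coordinates agree by the choice of [kap], the y coordinates because y vanishes
     at [x0], and h recovers the point. *)
  rewrite -(hchi' _ OF) -(hchi' _ OG); congr h.
  apply: coords_eq.
  - by rewrite prxF // prxG.
  - by apply/eqP; rewrite -subr_eq0 -hy // y0.
  - by rewrite prvG.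
  - by rewrite przF // przG.
split=> // w.
have dchiF : differentiable chi (F x0) by apply: chiC.1.
have dchiG : differentiable chi (Gm (kap x0)) by apply: chiC.1.
pose a := chi \o F; pose b := chi \o Gm.
have da : differentiable a x0 by exact: differentiable_comp.
have db : differentiable b (kap x0) by exact: differentiable_comp.
have daE xi : 'd a x0 xi = 'd chi (F x0) ('d F x0 xi) by rewrite (diff_comp dF dchiF).
have dbE tau : 'd b (kap x0) tau = 'd chi (F x0) ('d Gm (kap x0) tau).
  by rewrite (diff_comp dG dchiG) FG.
have fr1 := framed_coords.
have fr2 : framed ('rV[R]_u * 'rV[R]_m * 'rV[R]_c)%type.
  by do ![apply: framed_prod]; exact: framed_rV.
have dlin (Z : normedModType R)
    (L : {linear ('rV[R]_u * 'rV[R]_m * 'rV[R]_c)%type -> Z}) t :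
    differentiable L t /\ 'd L t = L :> (_ -> Z).
  have Lc := framed_linear_continuous (L := L) fr2.
  by split; [exact: linear_differentiable|exact: diff_lin].
have ax xi : prx ('d a x0 xi) = xi.
  have -> : prx ('d a x0 xi) = 'd id x0 xi.
    apply: (diff_linear_near (L := prx_lin) _ fr1 da); first by case: (is_diff_id x0).
    exact: near_eq_open oU prxF Ux0.
  by rewrite diff_id.
have az xi : prz ('d a x0 xi) = 0.
  have -> : prz ('d a x0 xi) = 'd (cst zst) x0 xi.
    apply: (diff_linear_near (L := prz_lin) _ fr1 da).
      exact: differentiable_cst.
    exact: near_eq_open oU przF Ux0.
  by rewrite diff_cst.
have bx tau : prx ('d b (kap x0) tau) = tau.1.1.
  have [d1 D1] := dlin _ (fst \o fst) (kap x0).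
  have := diff_linear_near (L := prx_lin) tau fr1 db d1 (near_eq_open oD prxG Dk).
  by rewrite D1.
have bv tau : prv ('d b (kap x0) tau) = tau.1.2.
  have [d1 D1] := dlin _ (snd \o fst) (kap x0).
  have := diff_linear_near (L := prv_lin) tau fr1 db d1 (near_eq_open oD prvG Dk).
  by rewrite D1.
have bz tau : prz ('d b (kap x0) tau) = tau.2.
  have [d1 D1] := dlin _ snd (kap x0).
  have := diff_linear_near (L := prz_lin) tau fr1 db d1 (near_eq_open oD przG Dk).
  by rewrite D1.
have [dva Dva] :=
  differentiable_linear_comp (framed_linear_continuous (L := prv_lin) fr1) da.
have dkap : is_diff x0 kap (fun xi => (xi, prv ('d a x0 xi), 0)).
  have h1 : is_diff x0 (prv_lin \o a) (fun xi => prv ('d a x0 xi)).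
    split; first exact: dva.
    apply/funext => xi.
    by rewrite -(deriveE xi dva) Dva (deriveE xi da).
  exact: (is_diff_pair (is_diff_pair (is_diff_id x0) h1) (is_diff_cst zst x0)).
have [dk Dkap] := dkap.
(* Varying x also moves the base point of the second graph: its v coordinate follows that of F,
   while z stays fixed. *)
have dyE xi : 'd y x0 xi =
    pry ('d a x0 xi) - pry ('d b (kap x0) (xi, prv ('d a x0 xi), 0)).
  have dbk : differentiable (b \o kap) x0 by exact: differentiable_comp.
  have pc := framed_linear_continuous (L := pry_lin) fr1.
  have [d1 _] := differentiable_linear_comp pc da.
  have [d2 _] := differentiable_linear_comp pc dbk.
  have dd : differentiable ((pry_lin \o a) - (pry_lin \o (b \o kap))) x0.
    exact: differentiableB.
  have [|_ ->] := near_eq_differentiable (g := y) _ dd.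
    by apply: near_eq_open oU _ Ux0 => x Ux; rewrite hy.
  have E1 := diff_linear_comp pry_lin xi fr1 da.
  have E2 : 'd (pry_lin \o (b \o kap)) x0 xi =
      pry ('d b (kap x0) (xi, prv ('d a x0 xi), 0)).
    apply: etrans (diff_linear_comp pry_lin xi fr1 dbk) _; congr (pry_lin _).
    apply: etrans (diff_comp_apply xi dk db) _; congr ('d b (kap x0) _).
    exact: (congr1 (fun g => g xi) Dkap).
  rewrite (diffB d1 d2); exact: (congr2 (fun p q => p - q) E1 E2).
(* The x, v and z components of the desired decomposition force [tau] once [xi] is chosen. The y
   component then becomes [rest] plus the derivative of y along [xi], and invertibility of the
   Jacobian of y solves for [xi]. *)
pose om := 'd chi (F x0) w.
pose rest := pry ('d b (kap x0) (prx om, prv om, prz om)).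
pose xi := (pry om - rest) *m invmx ('J y x0).
have dyxi : 'd y x0 xi = pry om - rest.
  by rewrite -(deriveE xi dy) (deriveEjacobian xi dy) mulmxKV.
pose tau := (prx om - xi, prv om - prv ('d a x0 xi), prz om).
exists xi, tau; apply: (local_coordinates_diff_inj hchi OF).
rewrite linearD -daE -dbE -/om.
have btau : 'd b (kap x0) tau = 'd b (kap x0) (prx om, prv om, prz om)
    - 'd b (kap x0) (xi, prv ('d a x0 xi), 0).
  by rewrite -linearB; congr ('d b _ _); rewrite /tau; congr (_, _, _); rewrite subr0.
apply: coords_eq.
- change (prx om = prx ('d a x0 xi) + prx ('d b (kap x0) tau)).
  by rewrite ax bx /= addrC subrK.
- rewrite btau; change (pry om = pry ('d a x0 xi) +
    (rest - pry ('d b (kap x0) (xi, prv ('d a x0 xi), 0)))).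
  by rewrite addrCA -dyE dyxi addrC subrK.
- change (prv om = prv ('d a x0 xi) + prv ('d b (kap x0) tau)).
  by rewrite bv /= addrC subrK.
- change (prz om = prz ('d a x0 xi) + prz ('d b (kap x0) tau)).
  by rewrite az bz add0r.
Qed.

End Coordinates.

(** At a boundary point of A the map f itself need not be differentiable, but its composite with a
    map from an open set into A is. It serves to freeze the parameter e. *)
Lemma Ck_on_differentiable k (V W Z : normedModType R) (f : V -> W)
    (A : set V) (i : Z -> V) (D : set Z) z :
  Ck_on k.+1 f A -> open D -> (forall t, D t -> A (i t)) -> D z ->
  differentiable i z -> differentiable (f \o i) z.
Proof.
move=> [G [g [oG AG gC fg]]] oD DA Dz di.
have dg : differentiable g (i z) by apply: gC.1; exact/AG/DA.
have [|//] := near_eq_differentiable (g := f \o i) _ (differentiable_comp di dg).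
by apply: near_eq_open oD _ Dz => t Dt /=; rewrite fg //; exact: DA.
Qed.

End Transversality.

Section Products.
Context {R : realType}.

Lemma open_prod (V W : normedModType R) (A : set V) (B : set W) :
  open A -> open B -> open (A `*` B).
Proof.
move=> oA oB; rewrite (_ : A `*` B = fst @^-1` A `&` snd @^-1` B) //.
by apply: openI; apply: open_comp => // -[x y] _; [exact: cvg_fst|exact: cvg_snd].
Qed.

Lemma differentiable_framed (V W : normedModType R) (L : {linear V -> W}) x :
  framed V -> differentiable L x.
Proof.
by move=> frV; apply: linear_differentiable; exact: framed_linear_continuous.
Qed.

End Products.

(** * Regularity of the splitting distance, and transversality at its nondegenerate zeros *)

Section SplittingDistance.
Context {R : realType} {n u m c du ds : nat}.
Local Notation coords := ('rV[R]_u * 'rV[R]_u * 'rV[R]_m * 'rV[R]_c)%type.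
Context {O : set 'rV[R]_n} {chi : 'rV[R]_n -> coords} {E : set R}
  {U : set 'rV[R]_u} {V : set 'rV[R]_m} {K : set 'rV[R]_c}
  {Du : set 'rV[R]_du} {Ds : set 'rV[R]_ds}
  {wu : R -> 'rV[R]_du -> 'rV[R]_n} {ws : R -> 'rV[R]_ds -> 'rV[R]_n}
  {cu : R -> 'rV[R]_u -> 'rV[R]_c -> 'rV[R]_du}
  {cs : R -> 'rV[R]_u -> 'rV[R]_m -> 'rV[R]_c -> 'rV[R]_ds}
  {zst : 'rV[R]_c} {vst : R -> 'rV[R]_u -> 'rV[R]_m}
  {y : R -> 'rV[R]_u -> 'rV[R]_u}.
Hypotheses (hchi : local_coordinates O chi)
  (oU : open U) (oV : open V) (oK : open K) (Kz : K zst).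
Hypothesis wuC : Ck_on 2 (fun t : R^o * 'rV[R]_du => wu t.1 t.2) (E `*` Du).
Hypothesis wsC : Ck_on 2 (fun t : R^o * 'rV[R]_ds => ws t.1 t.2) (E `*` Ds).
Hypothesis cuC : Ck_on 2
  (fun t : R^o * 'rV[R]_u * 'rV[R]_c => cu t.1.1 t.1.2 t.2) (E `*` U `*` K).
Hypothesis csC : Ck_on 2
  (fun t : R^o * 'rV[R]_u * 'rV[R]_m * 'rV[R]_c =>
     cs t.1.1.1 t.1.1.2 t.1.2 t.2) (E `*` U `*` V `*` K).
Hypothesis hcu : forall e x z, E e -> U x -> K z ->
  [/\ Du (cu e x z), O (wu e (cu e x z))
    & prxz (chi (wu e (cu e x z))) = row_mx x z].
Hypothesis hcs : forall e x v z, E e -> U x -> V v -> K z ->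
  [/\ Ds (cs e x v z), O (ws e (cs e x v z))
    & prxvz (chi (ws e (cs e x v z))) = row_mx (row_mx x v) z].
Hypothesis hvst : forall e x, E e -> U x ->
  vst e x = prv (chi (wu e (cu e x zst))) /\ V (vst e x).
Hypothesis hy : forall e x, E e -> U x ->
  y e x = pry (chi (wu e (cu e x zst)))
        - pry (chi (ws e (cs e x (vst e x) zst))).

Let frR : framed (R^o : normedModType R) := framed_regular.
Let fr k : framed 'rV[R]_k := framed_rV k.
Let frc : framed coords := framed_coords.
Let frX : framed (R^o * 'rV[R]_u)%type := framed_prod frR (fr u).
Local Notation X := (R^o * 'rV[R]_u)%type.

Lemma splitting_distance_Ck : Ck_on 2 (fun t : X => y t.1 t.2) (E `*` U).
Proof.
have fstC : Ck_on 2 (fst : X -> R^o) (E `*` U) by exact: (Ck_on_linear 2 fst _ frX).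
have sndC : Ck_on 2 (snd : X -> 'rV[R]_u) (E `*` U).
  exact: (Ck_on_linear 2 snd _ frX).
have zstC : Ck_on 2 (cst zst : X -> 'rV[R]_c) (E `*` U) by exact: Ck_on_cst.
have cuzC : Ck_on 2 (fun t : X => cu t.1 t.2 zst) (E `*` U).
  have iC := Ck_on_pair frX (fr _) (Ck_on_pair frR (fr _) fstC sndC) zstC.
  apply: (Ck_on_comp (framed_prod frX (fr _)) _ iC cuC) => t [Et Ut].
  by split; [split|].
have chiC : Ck_on 2 chi O by case: hchi => oO chiC _ _; exact: Ck_on_open.
have aC : Ck_on 2 (fun t : X => chi (wu t.1 (cu t.1 t.2 zst))) (E `*` U).
  have iC := Ck_on_pair frR (fr _) fstC cuzC.
  have wC : Ck_on 2 (fun t : X => wu t.1 (cu t.1 t.2 zst)) (E `*` U).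
    apply: (Ck_on_comp (framed_prod frR (fr _)) _ iC wuC) => t [Et Ut].
    by have [Dut _ _] := hcu Et Ut Kz.
  apply: (Ck_on_comp (fr _) _ wC chiC) => t [Et Ut].
  by have [_ Ot _] := hcu Et Ut Kz.
have vC : Ck_on 2 (fun t : X => vst t.1 t.2) (E `*` U).
  have paC := @Ck_on_linear_comp R 2 X coords 'rV[R]_m prv_lin _ _ frc aC.
  refine (Ck_on_eq _ paC) => t [Et Ut].
  exact: (esym (hvst Et Ut).1).
have hS t : (E `*` U) t -> [/\ Ds (cs t.1 t.2 (vst t.1 t.2) zst),
    O (ws t.1 (cs t.1 t.2 (vst t.1 t.2) zst)) & V (vst t.1 t.2)].
  by move=> [Et Ut]; have [_ Vt] := hvst Et Ut; have [] := hcs Et Ut Vt Kz.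
have cszC : Ck_on 2 (fun t : X => cs t.1 t.2 (vst t.1 t.2) zst) (E `*` U).
  have frXv := framed_prod frX (fr m).
  have iC := Ck_on_pair frXv (fr _)
    (Ck_on_pair frX (fr _) (Ck_on_pair frR (fr _) fstC sndC) vC) zstC.
  apply: (Ck_on_comp (framed_prod frXv (fr _)) _ iC csC) => t EUt.
  by have [_ _ Vt] := hS t EUt; case: EUt => Et Ut; do ![split].
have bC : Ck_on 2 (fun t : X => chi (ws t.1 (cs t.1 t.2 (vst t.1 t.2) zst)))
    (E `*` U).
  have iC := Ck_on_pair frR (fr _) fstC cszC.
  have wC : Ck_on 2 (fun t : X => ws t.1 (cs t.1 t.2 (vst t.1 t.2) zst)) (E `*` U).
    apply: (Ck_on_comp (framed_prod frR (fr _)) _ iC wsC) => t EUt.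
    by have [Dt _ _] := hS t EUt; case: EUt.
  apply: (Ck_on_comp (fr _) _ wC chiC) => t EUt.
  by have [_ Ot _] := hS t EUt.
have paC := @Ck_on_linear_comp R 2 X coords 'rV[R]_u pry_lin _ _ frc aC.
have pbC := @Ck_on_linear_comp R 2 X coords 'rV[R]_u (\- pry_lin) _ _ frc bC.
refine (Ck_on_eq _ (Ck_on_add paC pbC)) => t [Et Ut].
exact: (esym (hy Et Ut)).
Qed.

(** The two graphs are wu composed with cu and ws composed with cs at fixed e, so by the chain rule
    their tangent vectors lie in the row spaces of the Jacobians of the parameterisations. *)
Lemma splitting_distance_transversal e x0 :
  E e -> U x0 -> y e x0 = 0 -> differentiable (y e) x0 ->
  'J (y e) x0 \in unitmx ->
  (forall t, Du t -> differentiable (wu e) t) ->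
  (forall t, Ds t -> differentiable (ws e) t) ->
  let tu := cu e x0 zst in let ts := cs e x0 (vst e x0) zst in
  wu e tu = ws e ts /\
  forall w, exists (hu : 'rV[R]_du) (hs : 'rV[R]_ds),
    w = hu *m 'J (wu e) tu + hs *m 'J (ws e) ts.
Proof.
move=> Ee Ux0 y0 dy Jy dwu dws tu ts.
pose T := ('rV[R]_u * 'rV[R]_m * 'rV[R]_c)%type.
pose F x := wu e (cu e x zst).
pose Gm (t : T) := ws e (cs e t.1.1 t.1.2 t.2).
pose D : set T := U `*` V `*` K.
pose kap x : T := (x, prv (chi (F x)), zst).
have oD : open D by apply: open_prod => //; exact: open_prod.
have [vE V0] := hvst Ee Ux0.
have kap0 : kap x0 = (x0, vst e x0, zst) by rewrite /kap vE.
have Dk0 : D (kap x0) by rewrite kap0.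
have dcu : differentiable (fun x => cu e x zst) x0.
  have di : differentiable (fun x : 'rV[R]_u => ((e : R^o, x), zst)) x0.
    apply: differentiable_pair; last exact: differentiable_cst.
    exact: (diff_pairl (e : R^o) x0).1.
  have UA x : U x -> (E `*` U `*` K) ((e : R^o, x), zst).
    by move=> Ux; do ![split].
  exact: (Ck_on_differentiable cuC oU UA Ux0 di).
have dcs : differentiable (fun t : T => cs e t.1.1 t.1.2 t.2) (kap x0).
  have frT : framed T by exact: (framed_prod (framed_prod (fr u) (fr m)) (fr c)).
  have di : differentiable (fun t : T => (((e : R^o, t.1.1), t.1.2), t.2)) (kap x0).
    apply: differentiable_pair; last exact: (differentiable_framed snd _ frT).
    apply: differentiable_pair; last exact: (differentiable_framed (snd \o fst) _ frT).
    apply: differentiable_pair; last exact: (differentiable_framed (fst \o fst) _ frT).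
    exact: differentiable_cst.
  have DA t : D t -> (E `*` U `*` V `*` K) (((e : R^o, t.1.1), t.1.2), t.2).
    by move=> [[Ut Vt] Kt]; do ![split].
  exact: (Ck_on_differentiable csC oD DA Dk0 di).
have [Dtu _ _] := hcu Ee Ux0 Kz.
have [Dts _ _] := hcs Ee Ux0 V0 Kz.
have dGu : differentiable (wu e) (cu e x0 zst) by exact: dwu.
have dGs : differentiable (ws e) (cs e (kap x0).1.1 (kap x0).1.2 (kap x0).2).
  by rewrite kap0; exact: dws.
have dF : differentiable F x0 by exact: (differentiable_comp dcu dGu).
have dGm : differentiable Gm (kap x0) by exact: (differentiable_comp dcs dGs).
have hF x : U x -> [/\ O (F x), prxz (chi (F x)) = row_mx x zst & D (kap x)].
  move=> Ux; have [_ OF pF] := hcu Ee Ux Kz; split => //.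
  by have [vx Vx] := hvst Ee Ux; rewrite /kap -vx; do ![split].
have hG t : D t -> O (Gm t) /\
    prxvz (chi (Gm t)) = row_mx (row_mx t.1.1 t.1.2) t.2.
  by move=> [[Ut Vt] Kt]; have [] := hcs Ee Ut Vt Kt.
have hyk x : U x -> y e x = pry (chi (F x)) - pry (chi (Gm (kap x))).
  move=> Ux; rewrite /Gm /kap /= -(hvst Ee Ux).1; exact: hy.
have [FG span] := graphs_transversal hchi oU oD hF hG hyk Ux0 dF dGm y0 dy Jy.
rewrite -/(kap x0) in FG span.
split; first by move: FG; rewrite kap0.
move=> w; have [xi [tau ->]] := span w.
exists ('d (fun x => cu e x zst) x0 xi),
  ('d (fun t : T => cs e t.1.1 t.1.2 t.2) (kap x0) tau).
congr (_ + _).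
  apply: etrans (diff_comp_apply xi dcu dGu) _.
  by rewrite -(deriveE _ dGu) (deriveEjacobian _ dGu).
apply: etrans (diff_comp_apply tau dcs dGs) _.
rewrite -(deriveE _ dGs) (deriveEjacobian _ dGs).
by rewrite [in 'J _ _]kap0.
Qed.

End SplittingDistance.

Unset Implicit Arguments.
Set Strict Implicit.

(** * From a nondegenerate zero of the splitting distance to the invariant manifolds *)

Theorem theorem16 (R : realType) (n c s k1 k2 : nat)
  (* the unstable dimension is u = k1 + k2 *)
  (hus : (k1 + k2 < s)%N) (hn : n = (c + (k1 + k2) + s)%N)
  (eps0 : R) (heps0 : 0 < eps0)
  (E : set R) (hE : E = [set e | 0 <= e <= eps0])
  (* the family of ODEs, its flow, and the invariant manifolds *)
  (f : R -> 'rV[R]_n -> 'rV[R]_n)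
  (hf : forall k, Ck_on k (fun t : R^o * 'rV[R]_n => f t.1 t.2) (E `*` setT))
  (Phi : R -> R -> 'rV[R]_n -> 'rV[R]_n)
  (hPhi : forall e, E e -> is_flow (f e) (Phi e))
  (Lam : Type) (AL : set (chart R c Lam)) (hAL : is_atlas setT AL)
  (kappa : R -> Lam -> 'rV[R]_n)
  (hkappa : forall e, E e -> injective (kappa e) /\
    is_embedded (range (kappa e)) (push_atlas (kappa e) AL))
  (hNH : forall e, E e ->
    normally_hyperbolic (Phi e) (k1 + k2) s
      (range (kappa e)) (push_atlas (kappa e) AL))
  (* the center-unstable and center-stable manifolds *)
  (Acu : R -> set (chart R (k1 + k2 + c) 'rV[R]_n))
  (hAcu : forall e, E e -> is_immersed (Wcu (Phi e) (range (kappa e))) (Acu e))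
  (Acs : R -> set (chart R (s + c) 'rV[R]_n))
  (hAcs : forall e, E e -> is_immersed (Wcs (Phi e) (range (kappa e))) (Acs e))
  (wcu : R -> 'rV[R]_(k1 + k2) -> Lam -> 'rV[R]_n)
  (hwcu : parameterises E AL Acu wcu)
  (wcs : R -> 'rV[R]_s -> Lam -> 'rV[R]_n)
  (hwcs : parameterises E AL Acs wcs)
  (* local coordinates (x, y, v, z) on O *)
  (O : set 'rV[R]_n)
  (chi : 'rV[R]_n ->
    'rV[R]_(k1 + k2) * 'rV[R]_(k1 + k2) * 'rV[R]_(s - (k1 + k2)) * 'rV[R]_c)
  (hchi : local_coordinates O chi)
  (* charts of Lam used for the parameters cu and cs *)
  (au as_ : chart R c Lam) (hau : AL au) (has : AL as_)
  (U' : set 'rV[R]_(k1 + k2 + c)) (S' : set 'rV[R]_(s + c))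
  (hU' : [/\ open U', bounded_set U', U' `<=` chart_dom au
    & forall e t, E e -> U' t -> O (in_chart au wcu e t)])
  (hS' : [/\ open S', bounded_set S', S' `<=` chart_dom as_
    & forall e t, E e -> S' t -> O (in_chart as_ wcs e t)])
  (hA : enclosure_invertible
    [set 'J (fun r => prxz (chi (in_chart au wcu t.1 r))) t.2 | t in E `*` U'])
  (hB : enclosure_invertible
    [set 'J (fun r => prxvz (chi (in_chart as_ wcs t.1 r))) t.2
      | t in E `*` S'])
  (U : set 'rV[R]_(k1 + k2)) (V : set 'rV[R]_(s - (k1 + k2)))
  (K : set 'rV[R]_c)
  (hU : open U) (hV : open V) (hK : open K)
  (hUK : forall x z, U x -> K z -> exists e t,
    [/\ E e, U' t & prxz (chi (in_chart au wcu e t)) = row_mx x z])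
  (hUVK : forall x v z, U x -> V v -> K z -> exists e t,
    [/\ E e, S' t
      & prxvz (chi (in_chart as_ wcs e t)) = row_mx (row_mx x v) z])
  (cu : R -> 'rV[R]_(k1 + k2) -> 'rV[R]_c -> 'rV[R]_(k1 + k2 + c))
  (hcuC : Ck_on 2
    (fun t : R^o * 'rV[R]_(k1 + k2) * 'rV[R]_c => cu t.1.1 t.1.2 t.2)
    (E `*` U `*` K))
  (hcu : forall e x z, E e -> U x -> K z ->
    U' (cu e x z) /\ prxz (chi (in_chart au wcu e (cu e x z))) = row_mx x z)
  (cs : R -> 'rV[R]_(k1 + k2) -> 'rV[R]_(s - (k1 + k2)) -> 'rV[R]_c ->
    'rV[R]_(s + c))
  (hcsC : Ck_on 2
    (fun t : R^o * 'rV[R]_(k1 + k2) * 'rV[R]_(s - (k1 + k2)) * 'rV[R]_c =>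
       cs t.1.1.1 t.1.1.2 t.1.2 t.2)
    (E `*` U `*` V `*` K))
  (hcs : forall e x v z, E e -> U x -> V v -> K z ->
    S' (cs e x v z) /\
    prxvz (chi (in_chart as_ wcs e (cs e x v z))) = row_mx (row_mx x v) z)
  (zst : 'rV[R]_c) (hzst : K zst)
  (vst : R -> 'rV[R]_(k1 + k2) -> 'rV[R]_(s - (k1 + k2)))
  (hvst : forall e x, E e -> U x ->
    vst e x = prv (chi (in_chart au wcu e (cu e x zst))) /\ V (vst e x))
  (y : R -> 'rV[R]_(k1 + k2) -> 'rV[R]_(k1 + k2))
  (hy : forall e x, E e -> U x ->
    y e x = pry (chi (in_chart au wcu e (cu e x zst)))
          - pry (chi (in_chart as_ wcs e (cs e x (vst e x) zst))))
  (N1 : 'rV[R]_k1 -> R) (hN1 : is_norm N1)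
  (N2 : 'rV[R]_k2 -> R) (hN2 : is_norm N2)
  (p : 'rV[R]_(k1 + k2)) (r : R) (hr : 0 < r)
  (hUball : U = norm_ball (max_norm N1 N2) p r)
  (y1 : R -> 'rV[R]_(k1 + k2) -> 'rV[R]_k1)
  (hy1 : y1 = fun e x => lsubmx (y e x))
  (y2 : R -> 'rV[R]_(k1 + k2) -> 'rV[R]_k2)
  (hy2 : y2 = fun e x => rsubmx (y e x))
  (hy0p : y 0 p = 0)
  (hy20 : forall x, U x -> y2 0 x = 0)
  (* first derivative of y1 in x; mixed second derivative of y2 in x and e *)
  (dy1 : R -> 'rV[R]_(k1 + k2) -> 'M[R]_(k1 + k2, k1))
  (hdy1 : dy1 = fun e x => 'J (y1 e) x)
  (d2y2 : R -> 'rV[R]_(k1 + k2) -> 'M[R]_(k1 + k2, k2))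
  (hd2y2 : d2y2 = fun e x => derive_within E (fun t => 'J (y2 t) x) e)
  (A11 : 'M[R]_k1) (hA11 : A11 = usubmx (dy1 0 p))
  (A22 : 'M[R]_k2) (hA22 : A22 = dsubmx (d2y2 0 p))
  (Delta1 : set 'M[R]_(k1 + k2, k1))
  (hDelta1 : is_enclosure Delta1
    [set dy1 t.1 t.2 - col_mx A11 0 | t in E `*` U])
  (Delta2 : set 'M[R]_(k1 + k2, k2))
  (hDelta2 : is_enclosure Delta2
    [set d2y2 t.1 t.2 - col_mx 0 A22 | t in E `*` U])
  (hineq1 : (0 < k1)%N ->
    min_expansion N1 A11 * r >
      eps0 * set_norm N1 [set derive_within E (fun t => y1 t p) e | e in E]
      + set_norm (opnorm (max_norm N1 N2) N1) Delta1 * r)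
  (hineq2 : (0 < k2)%N ->
    min_expansion N2 A22 * r >
      set_norm N2 [set derive_within E (fun t => y2 t p) e | e in E]
      + set_norm (opnorm (max_norm N1 N2) N2) Delta2 * r) :
  forall e, 0 < e <= eps0 ->
    intersect_transversally
      (Wcu (Phi e) (range (kappa e))) (Acu e)
      (Wcs (Phi e) (range (kappa e))) (Acs e).
Proof.
move=> e he; have /andP[e0 eeps] := he.
have Ee : E e by rewrite hE /= (ltW e0).
have [oU' _ U'sub U'O] := hU'; have [oS' _ S'sub S'O] := hS'.
have [wuC wuA] := hwcu au hau; have [wsC wsA] := hwcs as_ has.
have hcu' e' x z : E e' -> U x -> K z ->
    [/\ chart_dom au (cu e' x z), O (in_chart au wcu e' (cu e' x z))
      & prxz (chi (in_chart au wcu e' (cu e' x z))) = row_mx x z].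
  move=> Ee' Ux Kz; have [U'x px] := hcu e' x z Ee' Ux Kz.
  by split; [exact: U'sub|exact: U'O|].
have hcs' e' x v z : E e' -> U x -> V v -> K z ->
    [/\ chart_dom as_ (cs e' x v z), O (in_chart as_ wcs e' (cs e' x v z))
      & prxvz (chi (in_chart as_ wcs e' (cs e' x v z))) = row_mx (row_mx x v) z].
  move=> Ee' Ux Vv Kz; have [S'x px] := hcs e' x v z Ee' Ux Vv Kz.
  by split; [exact: S'sub|exact: S'O|].
have yC := splitting_distance_Ck hchi hzst wuC wsC hcuC hcsC hcu' hcs' hvst hy.
have y1p0 : y1 0 p = 0 by rewrite hy1 hy0p linear0.
subst y1 y2 dy1 d2y2 A11 A22.
have [x0 [Ux0 yx0 dy Jy]] := nondegenerate_zero heps0 hE hN1 hN2 hr hU hUball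
  yC y1p0 hy20 hDelta1 hDelta2 hineq1 hineq2 he.
have [atu chu] := hAcu e Ee; have [ats chs] := hAcs e Ee.
have [imu _ _ _] := atu; have [ims _ _ _] := ats.
have dwu t : chart_dom au t -> differentiable (in_chart au wcu e) t.
  by move=> Dt; have [[d _] _] := chu _ (wuA e Ee); exact: d.
have dws t : chart_dom as_ t -> differentiable (in_chart as_ wcs e) t.
  by move=> Dt; have [[d _] _] := chs _ (wsA e Ee); exact: d.
have [Q span] := splitting_distance_transversal hchi hU hV hK hzst hcuC hcsC
  hcu' hcs' hvst hy Ee Ux0 yx0 dy Jy dwu dws.
have [Dtu _ _] := hcu' e x0 zst Ee Ux0 hzst.
have [Dts _ _] := hcs' e x0 (vst e x0) zst Ee Ux0 (hvst e x0 Ee Ux0).2 hzst.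
(* For each e in E the local parameterisations are charts of the two atlases: their images lie in
   the manifolds, and the row spaces of their Jacobians consist of tangent vectors. *)
exists (in_chart au wcu e (cu e x0 zst)); split.
- have [_ _ sub] := imu _ (wuA e Ee); apply: sub; by exists (cu e x0 zst).
- have [_ _ sub] := ims _ (wsA e Ee); apply: sub.
  by exists (cs e x0 (vst e x0) zst).
- move=> w; have [h1 [h2 ->]] := span w.
  exists (h1 *m 'J (in_chart au wcu e) (cu e x0 zst)),
    (h2 *m 'J (in_chart as_ wcs e) (cs e x0 (vst e x0) zst)); split.
  + exists (Chart (chart_dom au) (in_chart au wcu e)), (cu e x0 zst), h1.
    by split => //; exact: wuA.
  + exists (Chart (chart_dom as_) (in_chart as_ wcs e)),
      (cs e x0 (vst e x0) zst), h2.
    by split => //; exact: wsA.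
  + by [].
Qed.
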